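(* Let $n\ge1$ and $\beta\in\mathbb C\setminus\{0\}$. The center of $OY_\beta(\mathfrak{gl}_n)$ is generated by the coefficients $d_1,d_2,\dots$ of the quantum determinant $\mathrm{qdet}\,\tilde T(u)=1+d_1u^{-1}+d_2u^{-2}+\cdots$.
   Context: $OY_\beta(\mathfrak{gl}_n)$ is the unital associative $\mathbb C$-algebra with generators $\tilde t^{(r)}_{ij}$ ($1\le i,j\le n$, $r\ge1$) and relations $\left(u+\frac\beta u-v-\frac\beta v\right)[\tilde T_{ij}(u),\tilde T_{kl}(v)]=\tilde T_{kj}(u)\tilde T_{il}(v)-\tilde T_{kj}(v)\tilde T_{il}(u)$, where $\tilde T_{ij}(u)=\delta_{ij}+\sum_{r\ge1}\tilde t^{(r)}_{ij}u^{-r}$. For $c\in\mathbb C$ let $\phi_c(u)$ be the unique formal series in $u+\mathbb C[[u^{-1}]]$ with $\phi_c(u)+\beta/\phi_c(u)=u+\beta/u+c$; for a series $\phi(u)\in u+\mathbb C[[u^{-1}]]$, $\tilde T_{ij}(\phi(u)):=\sum_{r\ge0}\tilde t^{(r)}_{ij}\phi(u)^{-r}$ expanded in $u^{-1}$. Let $\tilde T_k(v)=\sum_{i,j}1^{\otimes(k-1)}\otimes E_{ij}\otimes1^{\otimes(n-k)}\otimes\tilde T_{ij}(v)\in\mathrm{End}(\mathbb C^n)^{\otimes n}\otimes OY_\beta(\mathfrak{gl}_n)[[u^{-1}]]$ and let $A_n$ be the antisymmetrizer $A_n(e_{i_1}\otimes\cdots\otimes e_{i_n})=\sum_{p\in S_n}\mathrm{sgn}(p)\,e_{i_{p(1)}}\otimes\cdots\otimes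 e_{i_{p(n)}}$. The quantum determinant $\mathrm{qdet}\,\tilde T(u)\in OY_\beta(\mathfrak{gl}_n)[[u^{-1}]]$ is the series such that $A_n\tilde T_1(u)\tilde T_2(\phi_{-1}(u))\cdots\tilde T_n(\phi_{-(n-1)}(u))=A_n\,\mathrm{qdet}\,\tilde T(u)$. *)

(* Defs.v *)
From HB Require Import structures.
From mathcomp Require Import all_boot all_order all_algebra all_fingroup.
From mathcomp Require Import complex.
From mathcomp Require Import reals.

Set Implicit Arguments.
Unset Strict Implicit.
Unset Printing Implicit Defensive.

Import Order.TTheory GRing.Theory Num.Theory.
Local Open Scope ring_scope.

(* Formal power series in one variable w (here w = u^{-1}) with coefficients
   in a ring, represented by their coefficient sequences: f = \sum_m f m w^m. *)

Definition mulS (K : pzRingType) (f g : nat -> K) : nat -> K :=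
  fun m => \sum_(i < m.+1) f i * g (m - i)%N.

Definition oneS (K : pzRingType) : nat -> K := fun m => (m == 0%N)%:R.

Definition shiftS (K : pzRingType) (f : nat -> K) : nat -> K :=
  fun m => if m is m'.+1 then f m' else 0.

Definition powS (K : pzRingType) (f : nat -> K) (r : nat) : nat -> K :=
  iter r (mulS f) (oneS K).

Section OY.
Variable R : realType.
Local Notation C := (R[i]).

(* psi = phi_c(u)^{-1}, written as a series in w = u^{-1}.
   phi_c(u) \in u + C[[u^{-1}]]  <->  psi \in w + w^2 C[[w]];
   phi + beta/phi = u + beta/u + c, multiplied by w*psi, reads
   w + beta w psi^2 = psi + beta w^2 psi + c w psi. *)
Definition phi_inv_spec (beta c : C) (psi : nat -> C) : Prop :=
  [/\ psi 0%N = 0, psi 1%N = 1 &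
   forall m, shiftS (oneS C) m + beta * shiftS (mulS psi psi) m
             = psi m + beta * shiftS (shiftS psi) m + c * shiftS psi m].

Variable n : nat.
Variable A : algType C.

(* generators: t i j r stands for \tilde t^{(r)}_{ij}, used only for r >= 1 *)
Definition tcoef (t : 'I_n -> 'I_n -> nat -> A) (i j : 'I_n) (r : nat) : A :=
  if r is 0 then (i == j)%:R else t i j r.

Definition commA (x y : A) : A := x * y - y * x.

(* The defining relation, coefficient of u^{-a} v^{-b} (a, b >= 0); all other
   coefficients vanish identically. *)
Definition OY_rel (beta : C) (t : 'I_n -> 'I_n -> nat -> A) : Prop :=
  forall (i j k l : 'I_n) (a b : nat),
    let X p q := commA (tcoef t i j p) (tcoef t k l q) in
    X a.+1 b + (if a is a'.+1 then beta *: X a' b else 0)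
      - X a b.+1 - (if b is b'.+1 then beta *: X a b' else 0)
    = tcoef t k j a * tcoef t i l b - tcoef t k j b * tcoef t i l a.

(* T_ij(phi(u)) = \sum_r t^{(r)}_ij phi(u)^{-r}, coefficient of u^{-m};
   only r <= m contribute since psi has order >= 1. *)
Definition Tphi (psi : nat -> C) (t : 'I_n -> 'I_n -> nat -> A) (i j : 'I_n) :
  nat -> A :=
  fun m => \sum_(r < m.+1) (powS psi r m) *: tcoef t i j r.

(* Coefficients of qdet T(u) = \sum_s sgn(s) T_{s(1)1}(u) T_{s(2)2}(phi_{-1}(u))
   ... T_{s(n)n}(phi_{-(n-1)}(u)), where phi_0(u) = u, psi c := phi_c^{-1}. *)
Definition qdet (psi : C -> nat -> C) (t : 'I_n -> 'I_n -> nat -> A) : nat -> A :=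
  fun m => \sum_(s : 'S_n)
     (-1) ^+ odd_perm s *:
       (\big[@mulS A/oneS A]_(k < n) Tphi (psi (- (k%:R))) t (s k) k) m.

End OY.

Section Alg.
Variable K : pzRingType.

Definition alg_hom (A B : algType K) (f : A -> B) : Prop :=
  [/\ forall x y, f (x + y) = f x + f y,
      forall x y, f (x * y) = f x * f y,
      f 1 = 1 &
      forall (c : K) x, f (c *: x) = c *: f x].

Inductive subalg_gen (A : algType K) (S : A -> Prop) : A -> Prop :=
| sg_in x : S x -> subalg_gen S x
| sg_scal (c : K) : subalg_gen S (c%:A)
| sg_add x y : subalg_gen S x -> subalg_gen S y -> subalg_gen S (x + y)
| sg_mul x y : subalg_gen S x -> subalg_gen S y -> subalg_gen S (x * y).
End Alg.

Definition is_OY (R : realType) (n : nat) (beta : R[i]) (A : algType R[i])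
    (t : 'I_n -> 'I_n -> nat -> A) : Prop :=
  OY_rel beta t /\
  forall (B : algType R[i]) (s : 'I_n -> 'I_n -> nat -> B), OY_rel beta s ->
    (exists f : A -> B, alg_hom f /\
        forall i j r, (0 < r)%N -> f (t i j r) = s i j r) /\
    (forall f g : A -> B, alg_hom f -> alg_hom g ->
        (forall i j r, (0 < r)%N -> f (t i j r) = g (t i j r)) ->
        forall x, f x = g x).

(* Main.v *)
Require Import Defs.
From HB Require Import structures.
From mathcomp Require Import all_boot all_order all_algebra all_fingroup.
From mathcomp Require Import complex.
From mathcomp Require Import boolp functions reals.
From mathcomp Require Import ring zify.
Set Implicit Arguments.
Unset Strict Implicit.
Unset Printing Implicit Defensive.

Import GRing.Theory.
Local Open Scope ring_scope.

(** Give [t^(r)] the weight [2r - 1].  A commutator then drops the weight by one, and its leading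
part is the bracket of [gl_n[x]]; so every element of the algebra has a symbol, a polynomial
function of the points [X = (X^(1), X^(2), ...)] of matrices, and commutators with the generators
become derivatives of symbols.

Symbols are well defined because of the following representations.  If [E] is a representation
of [gl_n], then [T(u) = 1 + E / (u + beta/u - a)] satisfies the relations, and so does a product
of such matrices with commuting entries.  Take [E_ij = x_i d_j], with [x_i] and [d_j] Heisenberg
generators shifted by scalars [s mu_i] and [s xi_j], and [a = s^4 al].  As [s] goes to infinity
the leading part of [t^(r)_ij] is [sum_k al_k^(r-1) mu_ki xi_kj], and up to any given level
every point is of this form.  Hence the symbol of 0 vanishes and these representations are jointly faithful, so the
centrality of the quantum determinant has to be checked only for them; there it is
multiplicative, and for a single factor the centrality is elementary.

Let now [z] be central with symbol [f].  Commuting [z] with [t^(N)] for large [N] shows that the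
derivative of [f] vanishes in all the directions [[Z, E_lk]], so [f] depends only on the traces of
the [X^(r)], which are the symbols of the coefficients [d_r].  Subtracting a polynomial in the
[d_r] lowers the weight of [z]. *)

(** * Power series and endomorphism algebras *)

Section PowerSeries.
Variable K : nzRingType.

Definition fps := nat -> K.
HB.instance Definition _ := gen_eqMixin fps.
HB.instance Definition _ := gen_choiceMixin fps.

Fact fps_addA : associative (fun f g : fps => (fun m => f m + g m) : fps).
Proof. by move=> f g h; apply: funext => m; rewrite addrA. Qed.
Fact fps_addC : commutative (fun f g : fps => (fun m => f m + g m) : fps).
Proof. by move=> f g; apply: funext => m; rewrite addrC. Qed.
Fact fps_add0 : left_id ((fun=> 0) : fps) (fun f g : fps => (fun m => f m + g m) : fps).
Proof. by move=> f; apply: funext => m; rewrite add0r. Qed.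
Fact fps_addN : left_inverse ((fun=> 0) : fps) (fun f : fps => (fun m => - f m) : fps)
  (fun f g : fps => (fun m => f m + g m) : fps).
Proof. by move=> f; apply: funext => m; rewrite addNr. Qed.
HB.instance Definition _ := GRing.isZmodule.Build fps fps_addA fps_addC fps_add0 fps_addN.

Lemma fpsD (f g : fps) m : (f + g) m = f m + g m. Proof. by []. Qed.
Lemma fpsN (f : fps) m : (- f) m = - f m. Proof. by []. Qed.
Lemma fps0 m : (0 : fps) m = 0. Proof. by []. Qed.

(** Up to a given degree a product of series only sees polynomial truncations, so associativity and
    commutativity are inherited from [{poly K}]. *)
Lemma mulS_poly (f g : nat -> K) M m : (m < M)%N ->
  mulS f g m = ((\poly_(i < M) f i) * (\poly_(i < M) g i))`_m.
Proof.
move=> mM; rewrite coefM; apply: eq_bigr => i _; rewrite !coef_poly.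
have -> : (i < M)%N by apply: leq_ltn_trans mM; rewrite -ltnS.
by have -> : (m - i < M)%N by apply: leq_ltn_trans mM; rewrite leq_subr.
Qed.

Fact fps_mulA : associative (@mulS K : fps -> fps -> fps).
Proof.
move=> f g h; apply: funext => m.
have trunc (a b : fps) i : (i < m.+1)%N ->
    (\poly_(i < m.+1) mulS a b i)`_i
    = ((\poly_(i < m.+1) a i) * (\poly_(i < m.+1) b i))`_i.
  by move=> im; rewrite coef_poly im (mulS_poly _ _ im).
rewrite !(@mulS_poly _ _ m.+1) // coefM [RHS]coefM.
under eq_bigr => i _ do rewrite trunc ?ltnS ?leq_subr //.
under [RHS]eq_bigr => i _ do rewrite trunc ?ltn_ord //.
by rewrite -!coefM mulrA.
Qed.

Fact fps_mul1 : left_id (oneS K : fps) (@mulS K : fps -> fps -> fps).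
Proof.
move=> f; apply: funext => m; rewrite /mulS big_ord_recl /= subn0 mul1r big1 ?addr0 //.
by move=> i _; rewrite /oneS /= mul0r.
Qed.

Fact fps_1mul : right_id (oneS K : fps) (@mulS K : fps -> fps -> fps).
Proof.
move=> f; apply: funext => m; rewrite /mulS big_ord_recr /= subnn mulr1 big1 ?add0r //.
move=> i _; rewrite /oneS /= subn_eq0 leqNgt ltn_ord /= mulr0 //.
Qed.

Fact fps_mulDl : left_distributive (@mulS K : fps -> fps -> fps) +%R.
Proof.
move=> f g h; apply: funext => m; rewrite fpsD /mulS -big_split.
by apply: eq_bigr => i _; rewrite mulrDl.
Qed.

Fact fps_mulDr : right_distributive (@mulS K : fps -> fps -> fps) +%R.
Proof.
move=> f g h; apply: funext => m; rewrite fpsD /mulS -big_split.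
by apply: eq_bigr => i _; rewrite mulrDr.
Qed.

Fact fps_one_neq0 : (oneS K : fps) != 0.
Proof.
by apply/eqP => /(congr1 (fun f : fps => f 0%N)) /eqP; rewrite /oneS /= oner_eq0.
Qed.

HB.instance Definition _ := GRing.Zmodule_isNzRing.Build fps fps_mulA fps_mul1 fps_1mul
  fps_mulDl fps_mulDr fps_one_neq0.

Lemma fpsM (f g : fps) : f * g = mulS f g. Proof. by []. Qed.
Lemma fps1 : 1 = oneS K :> fps. Proof. by []. Qed.

Lemma fps_sum I (r : seq I) (P : pred I) (F : I -> fps) m :
  (\sum_(i <- r | P i) F i) m = \sum_(i <- r | P i) F i m.
Proof. exact: (big_morph (fun f : fps => f m) (fun f g => fpsD f g m) (fps0 m)). Qed.

Definition fpsC (x : K) : fps := fun m => if m is 0 then x else 0.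

Lemma fpsCM (x : K) (f : fps) m : (fpsC x * f) m = x * f m.
Proof.
rewrite fpsM /mulS big_ord_recl /= subn0 big1 ?addr0 // => i _.
by rewrite mul0r.
Qed.

Lemma fpsMC (x : K) (f : fps) m : (f * fpsC x) m = f m * x.
Proof.
rewrite fpsM /mulS big_ord_recr /= subnn big1 ?add0r // => i _.
by rewrite /fpsC /=; case E: (m - i)%N (ltn_ord i) => [|k]; rewrite ?mulr0 // -subn_gt0 E.
Qed.

Fact fpsC_zmod : zmod_morphism fpsC.
Proof. by move=> x y; apply: funext => -[|m] //=; rewrite fpsD fpsN /= subr0. Qed.
Fact fpsC_monoid : monoid_morphism fpsC.
Proof.
split=> [|x y]; first by apply: funext => -[].
by apply: funext => m; rewrite fpsCM; case: m => //= m; rewrite mulr0.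
Qed.
HB.instance Definition _ := GRing.isZmodMorphism.Build K fps fpsC fpsC_zmod.
HB.instance Definition _ := GRing.isMonoidMorphism.Build K fps fpsC fpsC_monoid.

Definition fpsX : fps := shiftS (oneS K).

Lemma fpsXM (f : fps) : fpsX * f = shiftS f.
Proof.
apply: funext => -[|m]; rewrite fpsM /mulS big_ord_recl /= mul0r add0r ?big_ord0 //.
rewrite big_ord_recl /= /oneS mul1r big1 ?addr0 /bump /= ?subn1 //= => i _.
by rewrite mul0r.
Qed.

Lemma powSE (f : fps) r : powS f r = f ^+ r.
Proof. by elim: r => //= r IH; rewrite exprS -IH. Qed.

End PowerSeries.

Section ComPowerSeries.
Variable K : comNzRingType.
Fact fps_mulC : commutative (@GRing.mul (fps K)).
Proof.
move=> f g; apply: funext => m; rewrite !fpsM !(@mulS_poly _ _ _ m.+1) //.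
by rewrite mulrC.
Qed.
HB.instance Definition _ := GRing.PzRing_hasCommutativeMul.Build (fps K) fps_mulC.
End ComPowerSeries.

Section EndoAlgebra.
Variables (K : comNzRingType) (V : lmodType K) (v0 : V).
Hypothesis v0_neq0 : v0 != 0.

Definition is_lin (f : V -> V) := forall a u v, f (a *: u + v) = a *: f u + f v.

(** A nonzero vector is a parameter of the type because the ring instance has to prove [1 != 0]. *)
Record endo_ (v : V) (vn : v != 0) := Endo { endo_fun :> V -> V; endoP : is_lin endo_fun }.
Local Notation endo := (endo_ v0_neq0).

Lemma endo_eq (f g : endo) : (forall v, f v = g v) -> f = g.
Proof.
case: f g => f fP [g gP] /= /funext E; case: g / E gP => gP.
by congr Endo; apply: Prop_irrelevance.
Qed.

Fact endo_add_lin (f g : endo) : is_lin (fun v => f v + g v).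
Proof. by move=> a u v; rewrite !endoP scalerDr addrACA. Qed.
Fact endo_opp_lin (f : endo) : is_lin (fun v => - f v).
Proof. by move=> a u v; rewrite !endoP scalerN opprD. Qed.
Fact endo_0_lin : is_lin (fun=> 0).
Proof. by move=> a u v; rewrite scaler0 addr0. Qed.
Fact endo_1_lin : is_lin id.
Proof. by []. Qed.
Fact endo_mul_lin (f g : endo) : is_lin (fun v => f (g v)).
Proof. by move=> a u v; rewrite !endoP. Qed.
Fact endo_scale_lin (a : K) (f : endo) : is_lin (fun v => a *: f v).
Proof. by move=> b u v; rewrite endoP scalerDr !scalerA mulrC. Qed.

Definition endo_add f g : endo := Endo v0_neq0 (endo_add_lin f g).
Definition endo_opp f : endo := Endo v0_neq0 (endo_opp_lin f).
Definition endo_0 : endo := Endo v0_neq0 endo_0_lin.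
Definition endo_1 : endo := Endo v0_neq0 endo_1_lin.
Definition endo_mul f g : endo := Endo v0_neq0 (endo_mul_lin f g).
Definition endo_scale a f : endo := Endo v0_neq0 (endo_scale_lin a f).

HB.instance Definition _ := gen_eqMixin endo.
HB.instance Definition _ := gen_choiceMixin endo.

Fact endo_addA : associative endo_add.
Proof. by move=> f g h; apply: endo_eq => v /=; rewrite addrA. Qed.
Fact endo_addC : commutative endo_add.
Proof. by move=> f g; apply: endo_eq => v /=; rewrite addrC. Qed.
Fact endo_add0 : left_id endo_0 endo_add.
Proof. by move=> f; apply: endo_eq => v /=; rewrite add0r. Qed.
Fact endo_addN : left_inverse endo_0 endo_opp endo_add.
Proof. by move=> f; apply: endo_eq => v /=; rewrite addNr. Qed.
HB.instance Definition _ := GRing.isZmodule.Build endo endo_addA endo_addC endo_add0 endo_addN.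

Fact endo_mulA : associative endo_mul.
Proof. by move=> f g h; apply: endo_eq. Qed.
Fact endo_mul1 : left_id endo_1 endo_mul.
Proof. by move=> f; apply: endo_eq. Qed.
Fact endo_1mul : right_id endo_1 endo_mul.
Proof. by move=> f; apply: endo_eq. Qed.
Fact endo_mulDl : left_distributive endo_mul endo_add.
Proof. by move=> f g h; apply: endo_eq. Qed.
Fact endo_mulDr : right_distributive endo_mul endo_add.
Proof. by move=> f g h; apply: endo_eq => v /=; have := endoP f 1 (g v) (h v); rewrite !scale1r. Qed.
Fact endo_1_neq0 : endo_1 != 0.
Proof. by apply/eqP => /(congr1 (fun f : endo => f v0)) /= /eqP; apply/negP. Qed.
HB.instance Definition _ := GRing.Zmodule_isNzRing.Build endo endo_mulA endo_mul1 endo_1mul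
  endo_mulDl endo_mulDr endo_1_neq0.

Fact endo_scaleA a b f : endo_scale a (endo_scale b f) = endo_scale (a * b) f.
Proof. by apply: endo_eq => v /=; rewrite scalerA. Qed.
Fact endo_scale1 : left_id 1 endo_scale.
Proof. by move=> f; apply: endo_eq => v /=; rewrite scale1r. Qed.
Fact endo_scaleDr : right_distributive endo_scale +%R.
Proof. by move=> a f g; apply: endo_eq => v /=; rewrite scalerDr. Qed.
Fact endo_scaleDl f : {morph endo_scale^~ f: a b / a + b}.
Proof. by move=> a b; apply: endo_eq => v /=; rewrite scalerDl. Qed.
HB.instance Definition _ := GRing.Zmodule_isLmodule.Build K endo endo_scaleA endo_scale1
  endo_scaleDr endo_scaleDl.
Fact endo_scaleAl a (f g : endo) : a *: (f * g) = a *: f * g.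
Proof. by apply: endo_eq. Qed.
HB.instance Definition _ := GRing.Lmodule_isLalgebra.Build K endo endo_scaleAl.
Fact endo_scaleAr a (f g : endo) : a *: (f * g) = f * (a *: g).
Proof.
apply: endo_eq => v /=; have := endoP f a (g v) 0.
have -> : f 0 = 0 by have := endoP f (-1) 0 0; rewrite scaleN1r oppr0 addr0 scaleN1r addNr.
by rewrite !addr0.
Qed.
HB.instance Definition _ := GRing.Lalgebra_isAlgebra.Build K endo endo_scaleAr.

Lemma endoDE (f g : endo) v : (f + g) v = f v + g v. Proof. by []. Qed.
Lemma endoME (f g : endo) v : (f * g) v = f (g v). Proof. by []. Qed.
Lemma endoZE a (f : endo) v : (a *: f) v = a *: f v. Proof. by []. Qed.
Lemma endo1E v : (1 : endo) v = v. Proof. by []. Qed.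

End EndoAlgebra.

Section SubalgebraGenerated.
Variables (K : comNzRingType) (A : algType K) (S : A -> Prop).

(** Made boolean classically, so that the generated subalgebra becomes an algebra in its own right;
    [OY_gen] maps into it. *)
Definition subalg_pred : pred A := fun x => `[< subalg_gen S x >].

Fact subalg_pred_closed : subalg_closed subalg_pred.
Proof.
split.
- by apply/asboolP; rewrite -[1]scale1r; apply: sg_scal.
- move=> a u v /asboolP Su /asboolP Sv; apply/asboolP; apply: sg_add => //.
  by rewrite -mulr_algl; apply: sg_mul => //; apply: sg_scal.
- by move=> u v /asboolP Su /asboolP Sv; apply/asboolP; apply: sg_mul.
Qed.
HB.instance Definition _ := GRing.isSubalgClosed.Build K A subalg_pred
  (GRing.subalg_closed_semi subalg_pred_closed).

Record subalg := SubAlg { subalg_val : A; _ : subalg_val \in subalg_pred }.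
HB.instance Definition _ := [isSub for subalg_val].
HB.instance Definition _ := [Choice of subalg by <:].
HB.instance Definition _ := [SubChoice_isSubAlgebra of subalg by <:].
End SubalgebraGenerated.

(** * Words, weights and symbols *)

Lemma eqn_add_le a b p q : (a <= p)%N -> (b <= q)%N ->
  (a + b == p + q)%N = (a == p) && (b == q).
Proof. by move=> ap bq; apply/eqP/andP => [h|[/eqP -> /eqP ->] //]; split; apply/eqP; lia. Qed.

Section Words.
Variables (K : comNzRingType) (n : nat).

Definition letter : Type := ('I_n * 'I_n * nat)%type.
HB.instance Definition _ := Countable.on letter.

(* The letter (i, j, r) stands for t_ij^(r+1); with this weight commutators lose exactly one
   unit and the leading part of the commutator is the linear bracket of gl_n[x]. *)
Definition lwt (l : letter) : nat := (2 * l.2).+1.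
Definition wt (w : seq letter) : nat := \sum_(l <- w) lwt l.

Definition wordsum := seq (K * seq letter).

Variable A : algType K.
Variable x : letter -> A.

Definition wev (w : seq letter) : A := \prod_(l <- w) x l.
Definition sev (P : wordsum) : A := \sum_(p <- P) p.1 *: wev p.2.

Lemma wt_cat w w' : wt (w ++ w') = (wt w + wt w')%N.
Proof. by rewrite /wt big_cat. Qed.

Lemma wt_perm w w' : perm_eq w w' -> wt w = wt w'.
Proof. by move=> h; apply: perm_big. Qed.

Lemma wev_cat w w' : wev (w ++ w') = wev w * wev w'.
Proof. by rewrite /wev big_cat. Qed.

Lemma sev_cat P Q : sev (P ++ Q) = sev P + sev Q.
Proof. by rewrite /sev big_cat. Qed.

Lemma sev_nil : sev [::] = 0. Proof. exact: big_nil. Qed.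

Definition ws_scale (c : K) (P : wordsum) : wordsum := [seq (c * p.1, p.2) | p <- P].
Definition ws_mul (P Q : wordsum) : wordsum :=
  [seq (p.1 * q.1, p.2 ++ q.2) | p <- P, q <- Q].

Lemma sev_scale c P : sev (ws_scale c P) = c *: sev P.
Proof. by rewrite /sev big_map scaler_sumr; apply: eq_bigr => p _; rewrite scalerA. Qed.

Lemma sev_mul P Q : sev (ws_mul P Q) = sev P * sev Q.
Proof.
rewrite /sev big_allpairs_dep /= mulr_suml; apply: eq_bigr => p _.
rewrite mulr_sumr; apply: eq_bigr => q _.
by rewrite wev_cat -scalerAl -scalerAr scalerA.
Qed.

(** The bound is strict: [Lt 0] contains only zero, which is where the inductions on weight end. *)
Definition Lt (p : nat) (y : A) : Prop :=
  exists2 P : wordsum, all (fun cw => wt cw.2 < p)%N P & y = sev P.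

Lemma Lt_0 p : Lt p 0.
Proof. by exists [::]; rewrite ?sev_nil. Qed.

Lemma Lt_D p y z : Lt p y -> Lt p z -> Lt p (y + z).
Proof.
move=> [P hP ->] [Q hQ ->]; exists (P ++ Q); last by rewrite sev_cat.
by rewrite all_cat hP.
Qed.

Lemma Lt_Z p c y : Lt p y -> Lt p (c *: y).
Proof.
move=> [P hP ->]; exists (ws_scale c P); last by rewrite sev_scale.
by rewrite all_map.
Qed.

Lemma Lt_N p y : Lt p y -> Lt p (- y).
Proof. by move=> h; rewrite -scaleN1r; apply: Lt_Z. Qed.

Lemma Lt_B p y z : Lt p y -> Lt p z -> Lt p (y - z).
Proof. by move=> hy hz; apply: Lt_D => //; apply: Lt_N. Qed.

Lemma Lt_sum p I (r : seq I) (Q : pred I) (F : I -> A) :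
  (forall i, Q i -> Lt p (F i)) -> Lt p (\sum_(i <- r | Q i) F i).
Proof. by move=> h; elim/big_ind: _ => //; [exact: Lt_0 | exact: Lt_D]. Qed.

Lemma Lt_le p q y : (p <= q)%N -> Lt p y -> Lt q y.
Proof.
move=> pq [P hP ->]; exists P => //; apply: sub_all hP => cw /= h.
exact: leq_trans h pq.
Qed.

Lemma Lt_M p q y z : Lt p y -> Lt q z -> Lt (p + q).-1 (y * z).
Proof.
move=> [P hP ->] [Q hQ ->]; exists (ws_mul P Q); last by rewrite sev_mul.
apply/allP => cw /allpairsP [[u v] /= [uP vQ ->]] /=.
by have := allP hP _ uP; have := allP hQ _ vQ; rewrite wt_cat /=; lia.
Qed.

Lemma Lt_wev p w : (wt w < p)%N -> Lt p (wev w).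
Proof.
move=> h; exists [:: (1, w)]; first by rewrite /= h.
by rewrite /sev big_seq1 scale1r.
Qed.

Lemma wev1 l : wev [:: l] = x l. Proof. exact: big_seq1. Qed.
Lemma wt1 l : wt [:: l] = lwt l. Proof. exact: big_seq1. Qed.

Lemma Lt_letter p l : (lwt l < p)%N -> Lt p (x l).
Proof. by move=> h; rewrite -wev1; apply: Lt_wev; rewrite wt1. Qed.

Lemma Lt_alg p c : (0 < p)%N -> Lt p (c%:A).
Proof.
move=> h; apply: Lt_Z; have -> : 1 = wev [::] by rewrite /wev big_nil.
by apply: Lt_wev; rewrite /wt big_nil.
Qed.

Lemma Lt0 y : Lt 0 y -> y = 0.
Proof. by move=> [[|cw P] // _ ->]; rewrite sev_nil. Qed.

Definition point := letter -> K.
Definition wpt (X : point) (w : seq letter) : K := \prod_(l <- w) X l.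
Definition top (p : nat) (P : wordsum) (X : point) : K :=
  \sum_(cw <- P | wt cw.2 == p) cw.1 * wpt X cw.2.

(** A relation, since an element has many expressions by words, whose tops could a priori differ;
    that they agree is [Sy_uniq]. *)
Definition Sy (p : nat) (f : point -> K) (y : A) : Prop :=
  exists P : wordsum, [/\ all (fun cw => wt cw.2 <= p)%N P, y = sev P & forall X, f X = top p P X].

Lemma Sy_ext p f g y : (forall X, f X = g X) -> Sy p f y -> Sy p g y.
Proof. by move=> h [P [? ? hf]]; exists P; split=> // X; rewrite -h. Qed.

Lemma Sy_Lt p f y : Sy p f y -> Lt p.+1 y.
Proof. by move=> [P [hP -> _]]; exists P. Qed.

Lemma Lt_Sy p y : Lt p y -> Sy p (fun=> 0) y.
Proof.
move=> [P hP ->]; exists P; split=> //; first by apply: sub_all hP => cw /ltnW.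
move=> X; rewrite /top big_seq_cond big1 // => cw /andP [/(allP hP)].
by rewrite ltn_neqAle => /andP [/negbTE ->].
Qed.

Lemma Sy_D p f g y z : Sy p f y -> Sy p g z -> Sy p (fun X => f X + g X) (y + z).
Proof.
move=> [P [hP -> hf]] [Q [hQ -> hg]]; exists (P ++ Q); split.
- by rewrite all_cat hP.
- by rewrite sev_cat.
- by move=> X; rewrite hf hg /top big_cat.
Qed.

Lemma Sy_Z p c f y : Sy p f y -> Sy p (fun X => c * f X) (c *: y).
Proof.
move=> [P [hP -> hf]]; exists (ws_scale c P); split.
- by rewrite all_map.
- by rewrite sev_scale.
- by move=> X; rewrite hf /top big_map mulr_sumr; apply: eq_bigr => cw _; rewrite mulrA.
Qed.

Lemma wpt_cat X w w' : wpt X (w ++ w') = wpt X w * wpt X w'.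
Proof. by rewrite /wpt big_cat. Qed.

Lemma Sy_M p q f g y z : Sy p f y -> Sy q g z -> Sy (p + q) (fun X => f X * g X) (y * z).
Proof.
move=> [P [hP -> hf]] [Q [hQ -> hg]]; exists (ws_mul P Q); split.
- apply/allP => cw /allpairsP [[u v] /= [uP vQ ->]] /=.
  by have := allP hP _ uP; have := allP hQ _ vQ; rewrite wt_cat /=; lia.
- by rewrite sev_mul.
- move=> X; rewrite hf hg /top big_mkcond [RHS]big_mkcond big_allpairs_dep /=.
  rewrite mulr_suml big_seq [RHS]big_seq; apply: eq_bigr => u uP.
  rewrite [X in _ * X]big_mkcond mulr_sumr big_seq [RHS]big_seq; apply: eq_bigr => v vQ /=.
  have := allP hP _ uP; have := allP hQ _ vQ; rewrite wt_cat wpt_cat /= => h1 h2.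
  have -> : (wt u.2 + wt v.2 == p + q)%N = (wt u.2 == p) && (wt v.2 == q).
    exact: eqn_add_le.
  by case: eqP => _; case: eqP => _ /=; rewrite ?mulr0 ?mul0r // mulrACA.
Qed.

Lemma Sy_sum p I (r : seq I) (F : I -> A) (f : I -> point -> K) :
  (forall i, Sy p (f i) (F i)) ->
  Sy p (fun X => \sum_(i <- r) f i X) (\sum_(i <- r) F i).
Proof.
move=> h; elim: r => [|i r IH].
  rewrite big_nil; apply: Sy_ext (Lt_Sy (Lt_0 p)) => X; rewrite big_nil //.
rewrite big_cons; apply: Sy_ext (Sy_D (h i) IH) => X; rewrite big_cons //.
Qed.

Lemma Sy_wev w : Sy (wt w) (fun X => wpt X w) (wev w).
Proof.
exists [:: (1, w)]; split; first by rewrite /= leqnn.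
  by rewrite /sev big_seq1 scale1r.
by move=> X; rewrite /top big_mkcond big_seq1 /= eqxx mul1r.
Qed.

Lemma Sy_letter l : Sy (lwt l) (fun X => X l) (x l).
Proof.
have := Sy_wev [:: l]; rewrite wev1 wt1; apply: Sy_ext => X.
by rewrite /wpt big_seq1.
Qed.

Lemma Sy_one : Sy 0 (fun=> 1) 1.
Proof.
have := Sy_wev [::]; rewrite /wt /wev !big_nil; apply: Sy_ext => X.
by rewrite /wpt big_nil.
Qed.

Lemma Sy_addLt p f y z : Sy p f y -> Lt p z -> Sy p f (y + z).
Proof.
move=> hy /Lt_Sy hz; apply: Sy_ext (Sy_D hy hz) => X; exact: addr0.
Qed.

(** Serves to lift a composed symbol back to the algebra, once each coordinate of [g X] is known to
    be the symbol of some element [Y l]. *)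
Lemma Sy_subst p (Y : letter -> A) (g : point -> point) (P : wordsum) :
  (forall l, Sy (lwt l) (fun X => g X l) (Y l)) ->
  Sy p (fun X => top p P (g X)) (\sum_(cw <- P | wt cw.2 == p) cw.1 *: \prod_(l <- cw.2) Y l).
Proof.
move=> hY.
have hw w : Sy (wt w) (fun X => wpt (g X) w) (\prod_(l <- w) Y l).
  elim: w => [|l w IH].
    rewrite /wt !big_nil; apply: Sy_ext Sy_one => X; rewrite /wpt big_nil //.
  rewrite /wt !big_cons; apply: Sy_ext (Sy_M (hY l) IH) => X; rewrite /wpt big_cons //.
rewrite big_mkcond.
have hcw (cw : K * seq letter) :
    Sy p (fun X => if wt cw.2 == p then cw.1 * wpt (g X) cw.2 else 0)
         (if wt cw.2 == p then cw.1 *: \prod_(l <- cw.2) Y l else 0).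
  case: eqP => [<-|_]; first by apply: Sy_Z; apply: hw.
  by apply: Lt_Sy; apply: Lt_0.
apply: Sy_ext (Sy_sum P hcw) => X.
by rewrite /top [RHS]big_mkcond.
Qed.

End Words.

(** * Interpolation and codes of words *)

Section Interpolation.
Variables (K : numFieldType) (V : lmodType K) (I : eqType).

(** By linearity the sum of [c i * g.[k i]] vanishes for every polynomial [g]; one that vanishes at
    all values of [k] but one isolates the total coefficient of that value. *)
Lemma power_sums_eq0 (r : seq I) (c : I -> K) (k : I -> nat) (F : nat -> V) :
  (forall s, \sum_(i <- r) c i * (k i)%:R ^+ s = 0) -> \sum_(i <- r) c i *: F (k i) = 0.
Proof.
move=> h.
have hg (g : {poly K}) : \sum_(i <- r) c i * g.[(k i)%:R] = 0.
  under eq_bigr => i _ do rewrite horner_coef mulr_sumr.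
  rewrite exchange_big big1 // => j _ /=.
  under eq_bigr => i _ do rewrite mulrCA.
  by rewrite -mulr_sumr h mulr0.
pose D := undup [seq k i | i <- r].
have -> : \sum_(i <- r) c i *: F (k i)
        = \sum_(i <- r) \sum_(e <- D) (c i * (k i == e)%:R) *: F e.
  rewrite big_seq [RHS]big_seq; apply: eq_bigr => i ir.
  rewrite (bigD1_seq (k i)) ?undup_uniq ?mem_undup ?map_f //= eqxx mulr1 big1 ?addr0 //.
  by move=> e; rewrite eq_sym => /negbTE ->; rewrite mulr0 scale0r.
rewrite exchange_big big1 // => e _; rewrite -scaler_suml.
pose g : {poly K} := \prod_(e' <- D | e' != e) ('X - (e'%:R)%:P).
have ge : g.[e%:R] != 0.
  rewrite horner_prod prodf_seq_neq0; apply/allP => e' _; apply/implyP => ne.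
  by rewrite hornerXsubC subr_eq0 Num.Theory.eqr_nat eq_sym.
suff -> : \sum_(i <- r) c i * (k i == e)%:R = 0 by rewrite scale0r.
apply: (mulIf ge); rewrite mul0r -[RHS](hg g) mulr_suml big_seq [RHS]big_seq.
apply: eq_bigr => i ir; rewrite -mulrA; congr (_ * _).
case: eqP => [->|/eqP ne]; first by rewrite mul1r.
rewrite mul0r; apply/esym/eqP; rewrite horner_prod prodf_seq_eq0.
apply/hasP; exists (k i); first by rewrite mem_undup map_f.
by rewrite ne hornerXsubC subrr eqxx.
Qed.

End Interpolation.

Fixpoint nth_prime (k : nat) : nat :=
  if k is k'.+1 then s2val (prime_above (nth_prime k')) else 2.

Lemma nth_prime_prime k : prime (nth_prime k).
Proof. by case: k => //= k; case: prime_above. Qed.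

Lemma nth_prime_inj : injective nth_prime.
Proof.
have mono a d : (nth_prime a < nth_prime (a + d.+1))%N.
  elim: d => [|d IH]; first by rewrite addn1 /=; case: (prime_above _).
  by apply: ltn_trans IH _; rewrite [(a + d.+2)%N]addnS /=; case: (prime_above _).
move=> a b h; case: (ltngtP a b) => // ab.
  by have := mono a (b - a.+1)%N; rewrite h addnS -addSn subnKC // ltnn.
by have := mono b (a - b.+1)%N; rewrite -h addnS -addSn subnKC // ltnn.
Qed.

Section WordCode.
Variable T : countType.

(** By unique factorisation the code records the multiplicity of each letter and forgets the order.
    Its [s]-th power is the monomial of the word evaluated at [s]-th powers of primes. *)
Definition word_code (w : seq T) : nat := \prod_(l <- w) nth_prime (pickle l).

Lemma word_code_gt0 w : (0 < word_code w)%N.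
Proof. by apply: prodn_gt0 => l; apply/prime_gt0/nth_prime_prime. Qed.

Lemma logn_word_code w l : logn (nth_prime (pickle l)) (word_code w) = count_mem l w.
Proof.
elim: w => [|a w IH]; first by rewrite /word_code big_nil logn1.
rewrite /word_code big_cons -/(word_code w) lognM ?word_code_gt0 ?prime_gt0 ?nth_prime_prime //=.
rewrite IH; congr (_ + _)%N.
rewrite logn_prime ?nth_prime_prime // (inj_eq nth_prime_inj) (inj_eq (pcan_inj pickleK)).
by rewrite eq_sym.
Qed.

Lemma word_code_perm w w' : word_code w = word_code w' -> perm_eq w w'.
Proof. by move=> h; apply/allP => l _ /=; rewrite -!logn_word_code h. Qed.

End WordCode.

Lemma zmod_move (V : zmodType) (a b c d e : V) : a + b - c - d = e -> a = c + d - b + e.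
Proof.
move/eqP; rewrite !subr_eq => /eqP ab; rewrite -(addrK b a) ab.
by rewrite [RHS]addrC addrA; congr (_ - _); rewrite (addrC c) addrA.
Qed.

Lemma zmod_regroup (V : zmodType) (a b c d e : V) : a + b - c + d - e = a - e + (b - c + d).
Proof. by rewrite -!addrA; congr (_ + _); rewrite [RHS]addrC -!addrA. Qed.

(** * Commutators and symbols in the algebra *)

Section Symbols.
Variables (R : realType) (n : nat) (beta : R[i]) (A : algType R[i])
  (t : 'I_n -> 'I_n -> nat -> A).
Local Notation C := (R[i]).
Hypothesis tOY : OY_rel beta t.

Local Notation x := (fun l : letter n => t l.1.1 l.1.2 l.2.+1).
Local Notation Lt := (Lt x).
Local Notation Sy := (Sy x).
Local Notation wx := (wev x).

Lemma commA_alg c y : commA (c%:A) y = 0 :> A.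
Proof. by rewrite /commA -scalerAl -scalerAr mul1r mulr1 subrr. Qed.

Lemma tcoef0 i j : tcoef t i j 0 = ((i == j)%:R)%:A.
Proof. by rewrite /= scaler_nat. Qed.

Lemma commA_tcoef0l i j y : commA (tcoef t i j 0) y = 0.
Proof. by rewrite tcoef0 commA_alg. Qed.

Lemma commA_tcoef0r i j y : commA y (tcoef t i j 0) = 0.
Proof. by rewrite -[commA _ _]opprK opprB -/(commA _ _) commA_tcoef0l oppr0. Qed.

(** The bracket of gl_n[x], with t^(m+1)_ij in the place of E_ij x^m. *)
Definition lead (i j k l : 'I_n) (m : nat) : A :=
  (k == j)%:R *: t i l m.+1 - (i == l)%:R *: t k j m.+1.

Lemma Lt_t p i j r : (2 * r + 1 < p)%N -> Lt p (t i j r.+1).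
Proof. by move=> h; apply: (@Lt_letter _ _ _ x p (i, j, r)); rewrite /lwt /=; lia. Qed.

Lemma Lt_lead p i j k l m : (2 * m + 1 < p)%N -> Lt p (lead i j k l m).
Proof. by move=> h; apply: Lt_B; apply: Lt_Z; apply: Lt_t. Qed.

(** Induction on [r]: the defining relation moves one unit from [r] to [s] at the cost of beta terms
    and quadratic terms, all of weight below the weight 2(r + s) + 1 of [lead]. *)
Lemma comm_lead r i j k l s :
  Lt (2 * r + 2 * s + 1) (commA (t i j r.+1) (t k l s.+1) - lead i j k l (r + s)).
Proof.
elim/ltn_ind: r i j k l s => -[|r] IH i j k l s.
  (* For t^(1) the bracket is exact, because the commutators with t^(0) vanish. *)
  have := tOY i j k l 0%N s.+1.
  rewrite /= -!/(tcoef t _ _ 0) !commA_tcoef0l scaler0 addr0 !subr0 => ->.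
  rewrite /lead add0n !tcoef0 -!scalerAl mul1r -scalerAr mulr1 subrr; exact: Lt_0.
have := tOY i j k l r.+1 s.+1; rewrite /= => E.
have {E}-> : commA (t i j r.+2) (t k l s.+1) =
    commA (t i j r.+1) (t k l s.+2)
    + beta *: commA (t i j r.+1) (tcoef t k l s)
    - beta *: commA (tcoef t i j r) (t k l s.+1)
    + (t k j r.+1 * t i l s.+1 - t k j s.+1 * t i l r.+1).
  exact: zmod_move E.
have h1 := IH r (ltnSn r) i j k l s.+1.
rewrite zmod_regroup; apply: Lt_D.
  have -> : (r.+1 + s = r + s.+1)%N by rewrite addnS.
  by apply: Lt_le h1; lia.
apply: Lt_D; first apply: Lt_B; first 2 last.
- have hM i' j' k' l' : Lt ((2 * r + 2) + (2 * s + 2)).-1 (t i' j' r.+1 * t k' l' s.+1).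
    by apply: Lt_M; apply: Lt_t; lia.
  have hM' i' j' k' l' : Lt ((2 * s + 2) + (2 * r + 2)).-1 (t i' j' s.+1 * t k' l' r.+1).
    by apply: Lt_M; apply: Lt_t; lia.
  by apply: Lt_B; [apply: Lt_le (hM _ _ _ _) | apply: Lt_le (hM' _ _ _ _)]; lia.
- apply: Lt_Z; case: s h1 => [|s] h1; first by rewrite commA_tcoef0r; apply: Lt_0.
  have h2 := IH r (ltnSn r) i j k l s.
  rewrite -[commA _ _](subrK (lead i j k l (r + s))); apply: Lt_D.
    by apply: Lt_le h2; lia.
  by apply: Lt_lead; lia.
- apply: Lt_Z; case: r IH h1 => [|r] IH h1; first by rewrite commA_tcoef0l; apply: Lt_0.
  have h2 := IH r (leqnSn r.+1) i j k l s.
  rewrite -[commA _ _](subrK (lead i j k l (r + s))); apply: Lt_D.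
    by apply: Lt_le h2; lia.
  by apply: Lt_lead; lia.
Qed.

Lemma commA_mull y z w : commA (y * z) w = commA y w * z + y * commA z w :> A.
Proof. by rewrite /commA mulrBl mulrBr !mulrA [RHS]addrC addrA subrK. Qed.
Lemma commA_mulr y z w : commA w (y * z) = commA w y * z + y * commA w z :> A.
Proof. by rewrite /commA mulrBl mulrBr !mulrA addrA subrK. Qed.
Lemma commA1l y : commA 1 y = 0 :> A. Proof. by rewrite /commA mulr1 mul1r subrr. Qed.
Lemma commA1r y : commA y 1 = 0 :> A. Proof. by rewrite /commA mulr1 mul1r subrr. Qed.

Lemma Lt_comm_letter l m : Lt (lwt l + lwt m) (commA (x l) (x m)).
Proof.
case: l => [[i j] r]; case: m => [[k l] s]; rewrite /lwt /=.
rewrite -[commA _ _](subrK (lead i j k l (r + s))); apply: Lt_D.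
  by apply: Lt_le (comm_lead _ _ _ _ _ _); lia.
by apply: Lt_lead; lia.
Qed.

Lemma wt_cons l w : wt (l :: w : seq (letter n)) = (lwt l + wt w)%N.
Proof. by rewrite /wt big_cons. Qed.
Lemma wev_cons l w : wx (l :: w) = x l * wx w.
Proof. by rewrite /wev big_cons. Qed.


Lemma Lt_comm_lw l w : Lt (lwt l + wt w) (commA (x l) (wx w)).
Proof.
elim: w => [|m w IH].
  by rewrite /wev big_nil commA1r; apply: Lt_0.
rewrite wev_cons commA_mulr; apply: Lt_D.
- apply: (@Lt_le _ _ _ _ ((lwt l + lwt m) + (wt w).+1).-1).
    by rewrite wt_cons; lia.
  by apply: Lt_M; [apply: Lt_comm_letter | apply: Lt_wev].
- apply: (@Lt_le _ _ _ _ ((lwt m).+1 + (lwt l + wt w)).-1).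
    by rewrite wt_cons; lia.
  by apply: Lt_M => //; apply: Lt_letter.
Qed.

Lemma Lt_comm_word v w : Lt (wt v + wt w) (commA (wx v) (wx w)).
Proof.
elim: v => [|m v IH].
  by rewrite /wev big_nil commA1l; apply: Lt_0.
rewrite wev_cons commA_mull; apply: Lt_D.
- apply: (@Lt_le _ _ _ _ ((lwt m + wt w) + (wt v).+1).-1).
    by rewrite wt_cons; lia.
  by apply: Lt_M; [apply: Lt_comm_lw | apply: Lt_wev].
- apply: (@Lt_le _ _ _ _ ((lwt m).+1 + (wt v + wt w)).-1).
    by rewrite wt_cons; lia.
  by apply: Lt_M => //; apply: Lt_letter.
Qed.

(** Permutations are generated by exchanges of adjacent blocks, and each exchange costs a commutator
    of words, which has lower weight. *)
Lemma Lt_perm v w : perm_eq v w -> Lt (wt v) (wx v - wx w).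
Proof.
move=> vw; pose P w' := perm_eq v w' /\ Lt (wt v) (wx v - wx w').
suff [] : P w by [].
apply: (@catCA_perm_ind _ P _ v w vw); last by split=> //; rewrite subrr; apply: Lt_0.
move=> s1 s2 s3 [h1 h2]; split; first by apply: perm_trans h1 _; rewrite perm_catCA.
rewrite -[wx v](subrK (wx (s1 ++ s2 ++ s3))) -addrA; apply: Lt_D => //.
rewrite !wev_cat !mulrA -mulrBl -/(commA _ _).
apply: (@Lt_le _ _ _ _ ((wt s1 + wt s2) + (wt s3).+1).-1).
  by rewrite (wt_perm h1) !wt_cat; lia.
by apply: Lt_M; [apply: Lt_comm_word | apply: Lt_wev].
Qed.

(* Evaluating at the points whose coordinates are the s-th powers of distinct primes separates
   words up to permutation. *)
Lemma Sy0_Lt p f y : Sy p f y -> (forall X, f X = 0) -> Lt p y.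
Proof.
move=> [P [hP -> hf]] f0.
pose Q := [seq cw <- P | wt cw.2 == p].
have hQ cw : cw \in Q -> wt cw.2 = p by rewrite mem_filter => /andP [/eqP].
have -> : sev x P = \sum_(cw <- Q) cw.1 *: wx cw.2 + sev x [seq cw <- P | wt cw.2 != p].
  rewrite /sev (bigID (fun cw : C * seq (letter n) => wt cw.2 == p)) /=.
  by rewrite -big_filter -[X in _ + X]big_filter.
apply: Lt_D; last first.
  exists [seq cw <- P | wt cw.2 != p] => //; apply/allP => cw.
  by rewrite mem_filter => /andP [h /(allP hP)]; rewrite ltn_neqAle h.
pose code (cw : C * seq (letter n)) := word_code cw.2.
(* [F e] is the word of the first term with code [e]. Terms with equal codes share it, and replacing
   a word by it costs only lower weight. *)
pose F (e : nat) : A := wx (nth (0, [::]) Q (index e [seq code cw | cw <- Q])).2.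
have F0 : \sum_(cw <- Q) cw.1 *: F (code cw) = 0.
  apply: power_sums_eq0 => s.
  have := f0 (fun l => (nth_prime (pickle l))%:R ^+ s).
  rewrite hf /top -big_filter => E; rewrite -[RHS]E; apply: eq_bigr => cw _; congr (_ * _).
  by rewrite /wpt /code /word_code natr_prod prodrXl.
have -> : \sum_(cw <- Q) cw.1 *: wx cw.2 = \sum_(cw <- Q) cw.1 *: (wx cw.2 - F (code cw)).
  by rewrite -[LHS]subr0 -[X in _ - X]F0 -sumrB; apply: eq_bigr => cw _; rewrite scalerBr.
rewrite big_seq; apply: Lt_sum => cw cwQ.
apply: Lt_Z; rewrite -(hQ _ cwQ); apply: Lt_perm.
have iQ : (index (code cw) [seq code cw | cw <- Q] < size Q)%N.
  by rewrite -(size_map code) index_mem map_f.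
apply: word_code_perm; rewrite -/(code cw) -/(code _).
by rewrite -(nth_map _ 0%N code iQ) nth_index ?map_f.
Qed.

(** Coordinate [a] is the symbol of the commutator of the letter [a] with t^(N+1)_kl; on symbols
    this commutator is the derivative along [br k l N X]. *)
Definition br (k l : 'I_n) (N : nat) (X : point C n) : point C n :=
  fun a => (k == a.1.2)%:R * X (a.1.1, l, a.2 + N)%N - (a.1.1 == l)%:R * X (k, a.1.2, a.2 + N)%N.

(** The derivative of the monomial of [w] at [X] in the direction [Y], by the Leibniz rule. *)
Fixpoint dpt (X Y : point C n) (w : seq (letter n)) : C :=
  if w is l :: w' then Y l * wpt X w' + X l * dpt X Y w' else 0.

Lemma Sy_comm_word k l N w :
  Sy (wt w + 2 * N) (fun X => dpt X (br k l N X) w) (commA (wx w) (t k l N.+1)).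
Proof.
elim: w => [|[[i j] r] w IH].
  rewrite /wev big_nil commA1l; apply: Lt_Sy; apply: Lt_0.
rewrite wev_cons commA_mull wt_cons; apply: Sy_D.
- rewrite addnAC; apply: Sy_M; last exact: Sy_wev.
  rewrite -[commA _ _](subrK (lead i j k l (r + N))) addrC.
  apply: Sy_addLt; last by rewrite /lwt; apply: Lt_le (comm_lead _ _ _ _ _ _); lia.
  have E : (lwt (i, j, r) + 2 * N = (2 * (r + N)).+1)%N by rewrite /lwt /=; lia.
  rewrite E /lead -scaleNr; apply: Sy_ext; last first.
    apply: Sy_D; apply: Sy_Z.
      exact: (Sy_letter x (i, l, r + N)%N).
    exact: (Sy_letter x (k, j, r + N)%N).
  by move=> X; rewrite /br /= mulNr.
- by rewrite -addnA; apply: Sy_M => //; apply: Sy_letter.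
Qed.

Lemma Sy_comm p P k l N : all (fun cw : C * seq (letter n) => wt cw.2 <= p)%N P ->
  Sy (p + 2 * N)
     (fun X => \sum_(cw <- P | wt cw.2 == p) cw.1 * dpt X (br k l N X) cw.2)
     (commA (sev x P) (t k l N.+1)).
Proof.
move=> hP.
have -> : commA (sev x P) (t k l N.+1)
        = \sum_(cw <- P) cw.1 *: commA (wx cw.2) (t k l N.+1).
  rewrite /commA /sev mulr_suml mulr_sumr -sumrB; apply: eq_bigr => cw _.
  by rewrite -scalerAl -scalerAr scalerBr.
elim: P hP => [_|cw P IH /= /andP [h /IH {}IH]].
  rewrite big_nil; apply: Sy_ext (Lt_Sy (Lt_0 _ _)) => X; rewrite big_nil //.
rewrite big_cons.
have hcw : Sy (p + 2 * N)
    (fun X => if wt cw.2 == p then cw.1 * dpt X (br k l N X) cw.2 else 0)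
    (cw.1 *: commA (wx cw.2) (t k l N.+1)).
  case: eqP h => [<- _|/eqP ne h]; first by apply: Sy_Z; apply: Sy_comm_word.
  apply: Lt_Sy; apply: Lt_Z; apply: Lt_le (Sy_Lt (Sy_comm_word k l N cw.2)).
  by rewrite -addSn leq_add2r ltn_neqAle ne.
apply: Sy_ext (Sy_D hcw IH) => X; rewrite big_cons; case: eqP => // _; exact: add0r.
Qed.

End Symbols.

(** * Products of solutions *)

Section SeriesMap.
Variables (K K' : nzRingType) (phi : {rmorphism K -> K'}).
Definition fps_map (f : fps K) : fps K' := fun m => phi (f m).
Fact fps_map_zmod : zmod_morphism fps_map.
Proof. by move=> f g; apply: funext => m; rewrite /fps_map !fpsD !fpsN rmorphB. Qed.
Fact fps_map_monoid : monoid_morphism fps_map.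
Proof.
split=> [|f g]; apply: funext => m; first by rewrite /fps_map !fps1 /oneS rmorph_nat.
rewrite /fps_map !fpsM /mulS rmorph_sum; apply: eq_bigr => i _; exact: rmorphM.
Qed.
HB.instance Definition _ := GRing.isZmodMorphism.Build (fps K) (fps K') fps_map fps_map_zmod.
HB.instance Definition _ :=
  GRing.isMonoidMorphism.Build (fps K) (fps K') fps_map fps_map_monoid.
End SeriesMap.

Lemma fpsX_comm (K : nzRingType) (f : fps K) : GRing.comm (fpsX K) f.
Proof.
apply: funext => m; rewrite fpsXM; case: m => [|m].
  by rewrite fpsM /mulS big_ord1 /= mulr0.
rewrite fpsM /mulS big_ord_recr /= subnn mulr0 addr0 big_ord_recr /= subSnn /oneS mulr1.
rewrite big1 ?add0r // => i _.
case E: (m.+1 - i)%N => [|[|k]] /=; rewrite ?mulr0 //.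
by have := ltn_ord i; lia.
Qed.

Lemma fpsC_comm (K : nzRingType) (c : K) (f : fps K) :
  (forall m, c * f m = f m * c) -> GRing.comm (fpsC c) f.
Proof. by move=> h; apply: funext => m; rewrite fpsCM fpsMC. Qed.

Lemma fps_commP (K : nzRingType) (f g : fps K) :
  (forall a b, f a * g b = g b * f a) -> GRing.comm f g.
Proof.
move=> h; apply: funext => m; rewrite !fpsM /mulS (reindex_inj rev_ord_inj) /=.
by apply: eq_bigr => i _; rewrite subSS subKn ?h // -ltnS.
Qed.

(* The RTT relation in a ring containing both spectral parameters; the factors g and k stand
   for the two central scalars clearing its denominators. *)
Definition rtt (D : nzRingType) (n : nat) (g k : D) (Tu Tv : 'I_n -> 'I_n -> D) :=
  forall i j i' j', g * (Tu i j * Tv i' j' - Tv i' j' * Tu i j)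
    = k * (Tu i' j * Tv i j' - Tv i' j * Tu i j').

(** After expanding both products, the relation is applied to the [L] factors with the [M] factors
    kept aside, and then to the [M] factors. *)
Lemma rtt_mul (D : nzRingType) (n : nat) (g k : D) (Lu Lv Mu Mv : 'I_n -> 'I_n -> D) :
  (forall x, GRing.comm g x) -> (forall x, GRing.comm k x) ->
  (forall i j i' j', [/\ GRing.comm (Mu i j) (Lu i' j'), GRing.comm (Mu i j) (Lv i' j'),
     GRing.comm (Mv i j) (Lu i' j') & GRing.comm (Mv i j) (Lv i' j')]) ->
  rtt g k Lu Lv -> rtt g k Mu Mv ->
  rtt g k (fun i j => \sum_c Lu i c * Mu c j) (fun i j => \sum_c Lv i c * Mv c j).
Proof.
move=> gC kC LM hL hM i j i' j'.
have mul4 (P Q : 'I_n -> 'I_n -> D) (P' Q' : 'I_n -> 'I_n -> D) a b a' b' :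
    (forall i j i' j', GRing.comm (P' i j) (Q i' j')) ->
    (\sum_c P a c * P' c b) * (\sum_d Q a' d * Q' d b')
      = \sum_c \sum_d P a c * Q a' d * (P' c b * Q' d b').
  move=> PQ; rewrite mulr_suml; apply: eq_bigr => c _.
  rewrite mulr_sumr; apply: eq_bigr => d _.
  by rewrite -!mulrA; congr (_ * _); rewrite !mulrA (PQ c b a' d).
have LM1 a b a' b' : GRing.comm (Mu a b) (Lv a' b') by case: (LM a b a' b').
have LM2 a b a' b' : GRing.comm (Mv a b) (Lu a' b') by case: (LM a b a' b').
rewrite !mul4 // [X in _ - X]exchange_big -sumrB mulr_sumr.
rewrite -sumrB [RHS]mulr_sumr.
have step c d :
    g * (Lu i c * Lv i' d * (Mu c j * Mv d j') - Lv i' d * Lu i c * (Mv d j' * Mu c j))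
    = k * (Lu i' c * Lv i d * (Mu c j * Mv d j') - Lv i' c * Lu i d * (Mu c j * Mv d j'))
    + k * (Lv i' d * Lu i c * (Mu d j * Mv c j') - Lv i' d * Lu i c * (Mv d j * Mu c j')).
  rewrite -!mulrBl -!mulrBr.
  have -> : Lu i c * Lv i' d * (Mu c j * Mv d j') - Lv i' d * Lu i c * (Mv d j' * Mu c j)
    = (Lu i c * Lv i' d - Lv i' d * Lu i c) * (Mu c j * Mv d j')
      + Lv i' d * Lu i c * (Mu c j * Mv d j' - Mv d j' * Mu c j).
    by rewrite mulrBl mulrBr addrA subrK.
  rewrite mulrDr; congr (_ + _); first by rewrite mulrA hL -mulrA.
  by rewrite [LHS]mulrA gC -mulrA hM [LHS]mulrA -kC -mulrA.
under eq_bigr => c _ do rewrite -sumrB mulr_sumr.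
under eq_bigr => c _ do under eq_bigr => d _ do rewrite step.
under [RHS]eq_bigr => c _ do rewrite -sumrB mulr_sumr.
have -> (F G : 'I_n -> 'I_n -> D) :
   \sum_c \sum_d (F c d + G c d) = \sum_c \sum_d F c d + \sum_c \sum_d G c d.
  by rewrite -big_split; apply: eq_bigr => c _; rewrite big_split.
(* The mixed terms left by the two applications cancel once the summation indices of the second sum
   are exchanged. *)
rewrite [X in _ + X]exchange_big -big_split; apply: eq_bigr => c _.
rewrite -big_split; apply: eq_bigr => d _ /=.
by rewrite -mulrDr addrA subrK.
Qed.

Section RTT.
Variables (R : realType) (n : nat) (beta : R[i]) (B : algType R[i]).
Local Notation C := (R[i]).
Local Notation D := (fps (fps B)).
Implicit Types t : 'I_n -> 'I_n -> nat -> B.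

(** In [D] the outer variable is 1/u and the inner one 1/v: [serU] is a series in u, constant in v,
    and [serV] the reverse. *)
Definition serU : fps B -> D := fps_map (@fpsC B).
Definition serV : fps B -> D := @fpsC (fps B).
HB.instance Definition _ := GRing.RMorphism.on serU.
HB.instance Definition _ := GRing.RMorphism.on serV.

Lemma serUVE f h a b : (serU f * serV h) a b = f a * h b.
Proof. by rewrite fpsMC fpsCM. Qed.
Lemma serVUE f h a b : (serV h * serU f) a b = h b * f a.
Proof. by rewrite fpsCM fpsMC. Qed.

Definition wu : D := fpsX (fps B).
Definition wv : D := fpsC (fpsX B).
Definition bD : D := fpsC (fpsC (beta%:A)).

(* Writing w = 1/u and z = 1/v, this is wz ((u + beta/u) - (v + beta/v)). *)
Definition rtt_den : D := wv + bD * (wu * (wu * wv)) - wu - bD * (wu * (wv * wv)).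

Lemma wuE (X : D) a b : (wu * X) a b = if a is a'.+1 then X a' b else 0.
Proof. by rewrite fpsXM; case: a. Qed.
Lemma wvE (X : D) a b : (wv * X) a b = if b is b'.+1 then X a b' else 0.
Proof. by rewrite fpsCM fpsXM; case: b. Qed.
Lemma bDE (X : D) a b : (bD * X) a b = beta *: X a b.
Proof. by rewrite !fpsCM -scalerAl mul1r. Qed.

Lemma wu_comm (X : D) : GRing.comm wu X.
Proof. exact: fpsX_comm. Qed.
Lemma wv_comm (X : D) : GRing.comm wv X.
Proof. by apply: fpsC_comm => m; apply: fpsX_comm. Qed.
Lemma bD_comm (X : D) : GRing.comm bD X.
Proof.
apply: fpsC_comm => m; apply: fpsC_comm => m'.
by rewrite -scalerAl -scalerAr mul1r mulr1.
Qed.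

Lemma comm_mulD (K : pzRingType) (x y z : K) : GRing.comm x z -> GRing.comm y z ->
  GRing.comm (x * y) z.
Proof. by rewrite /GRing.comm => h1 h2; rewrite -mulrA h2 mulrA h1 mulrA. Qed.

Lemma rtt_den_comm (X : D) : GRing.comm rtt_den X.
Proof.
have hu := wu_comm X; have hv := wv_comm X; have hb := bD_comm X.
have h1 : GRing.comm (bD * (wu * (wu * wv))) X by do 3! apply: comm_mulD => //.
have h2 : GRing.comm (bD * (wu * (wv * wv))) X by do 3! apply: comm_mulD => //.
apply/commr_sym; apply: commrB; last exact/commr_sym.
apply: commrB; last exact/commr_sym.
by apply: commrD; apply/commr_sym.
Qed.

Lemma rtt_denE (X : D) a b : (rtt_den * X) a.+1 b.+1 =
  X a.+1 b + (if a is a'.+1 then beta *: X a' b else 0)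
  - X a b.+1 - (if b is b'.+1 then beta *: X a b' else 0).
Proof.
rewrite /rtt_den !mulrBl mulrDl -!mulrA !(fpsD, fpsN) /=.
rewrite !bDE !wuE !wvE; case: a => [|a]; case: b => [|b]; rewrite /= ?wuE ?wvE ?scaler0 //.
Qed.

Lemma rtt_den0b (X : D) b : (rtt_den * X) 0%N b = if b is b'.+1 then X 0%N b' else 0.
Proof.
rewrite /rtt_den !mulrBl mulrDl -!mulrA !(fpsD, fpsN) /=.
by rewrite !bDE !wuE !wvE scaler0 addr0 !subr0.
Qed.

Lemma rtt_dena0 (X : D) a : (rtt_den * X) a.+1 0%N = - X a 0%N.
Proof.
rewrite /rtt_den !mulrBl mulrDl -!mulrA !(fpsD, fpsN) /=.
rewrite !bDE !wuE !wvE.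
by case: a => [|a]; rewrite ?wuE ?wvE !scaler0 add0r !add0r subr0.
Qed.

(** The coefficient with exponents a+1 and b+1 is the relation at [(a, b)]. When an exponent is zero
    both sides vanish, because t^(0) is scalar. *)
Lemma OY_rtt t : OY_rel beta t <->
  rtt rtt_den (wu * wv) (fun i j => serU (tcoef t i j)) (fun i j => serV (tcoef t i j)).
Proof.
have XE i j i' j' a b : (serU (tcoef t i j) * serV (tcoef t i' j')
    - serV (tcoef t i' j') * serU (tcoef t i j)) a b = commA (tcoef t i j a) (tcoef t i' j' b).
  by rewrite 2!fpsD 2!fpsN serUVE serVUE.
have YE i j i' j' a b : (serU (tcoef t i' j) * serV (tcoef t i j')
    - serV (tcoef t i' j) * serU (tcoef t i j')) a b
    = tcoef t i' j a * tcoef t i j' b - tcoef t i' j b * tcoef t i j' a.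
  by rewrite 2!fpsD 2!fpsN serUVE serVUE.
split=> [h i j i' j'|h i j i' j' a b].
- apply: funext => a; apply: funext => b; rewrite -mulrA wuE.
  case: a => [|a]; first by rewrite rtt_den0b; case: b => // b; rewrite XE commA_tcoef0l.
  rewrite wvE; case: b => [|b]; first by rewrite rtt_dena0 XE commA_tcoef0r oppr0.
  rewrite rtt_denE YE -h; case: a => [|a]; case: b => [|b]; rewrite !XE //.
- have := congr1 (fun f : D => f a.+1 b.+1) (h i j i' j').
  rewrite rtt_denE -mulrA wuE wvE YE => <-.
  by case: a => [|a]; case: b => [|b]; rewrite !XE.
Qed.

Definition tser t i j : fps B := tcoef t i j.
Definition tmul t s : 'I_n -> 'I_n -> nat -> B :=
  fun i j => \sum_c tser t i c * tser s c j.

Lemma fpsM0 (f g : fps B) : (f * g) 0%N = f 0%N * g 0%N.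
Proof. by rewrite fpsM /mulS big_ord1. Qed.

Lemma tser_tmul t s i j : tser (tmul t s) i j = \sum_c tser t i c * tser s c j.
Proof.
apply: funext => -[|m] //; rewrite fps_sum /tser /=.
under eq_bigr => c _ do rewrite fpsM0 /= -natrM mulnb.
rewrite (bigD1 i) //= eqxx /= big1 ?addr0 // => c /negbTE.
by rewrite eq_sym => ->.
Qed.

Lemma OY_rel_tmul t s : OY_rel beta t -> OY_rel beta s ->
  (forall i j r i' j' r', t i j r * s i' j' r' = s i' j' r' * t i j r) ->
  OY_rel beta (tmul t s).
Proof.
move=> /OY_rtt ht /OY_rtt hs ts; apply/OY_rtt.
have c i j a i' j' b : tcoef s i j a * tcoef t i' j' b = tcoef t i' j' b * tcoef s i j a.
  case: a => [|a]; first by rewrite /= (commr_nat).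
  case: b => [|b]; rewrite /= ?ts //. by rewrite -commr_nat.
have cc i j i' j' a b : GRing.comm (tser s i j a) (tser t i' j' b) by apply: c.
have EU : (fun i j => serU (tcoef (tmul t s) i j))
    = (fun i j => \sum_c serU (tcoef t i c) * serU (tcoef s c j)).
  apply: funext => i; apply: funext => j; rewrite -/(tser _ _ _) tser_tmul rmorph_sum.
  by apply: eq_bigr => k _; rewrite rmorphM.
have EV : (fun i j => serV (tcoef (tmul t s) i j))
    = (fun i j => \sum_c serV (tcoef t i c) * serV (tcoef s c j)).
  apply: funext => i; apply: funext => j; rewrite -/(tser _ _ _) tser_tmul rmorph_sum.
  by apply: eq_bigr => k _; rewrite rmorphM.
rewrite EU EV; apply: rtt_mul ht hs; first exact: rtt_den_comm.
  by move=> X; apply: comm_mulD; [apply: wu_comm | apply: wv_comm].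
move=> i j i' j'; have ccS : tser s i j * tser t i' j' = tser t i' j' * tser s i j.
  by apply: fps_commP => a b; apply: cc.
split.
- by rewrite /GRing.comm -!rmorphM; congr serU.
- by apply: funext => a; apply: funext => b; rewrite serUVE serVUE; apply: cc.
- by apply: funext => a; apply: funext => b; rewrite serUVE serVUE; apply: cc.
- by rewrite /GRing.comm -!rmorphM; congr serV.
Qed.

End RTT.

(** * Column determinants *)

(** [pre] and [suf] are chosen from [P0] before [P], so that several products differing only at two
    adjacent positions can be compared. *)
Lemma prod_split_adj (D : nzRingType) n (k k' : 'I_n) (P0 : 'I_n -> D) : k' = k.+1 :> nat ->
  exists pre suf : D, forall P : 'I_n -> D,
    (forall q, q != k -> q != k' -> P q = P0 q) -> \prod_q P q = pre * (P k * P k') * suf.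
Proof.
case: n k k' P0 => [[]//|n] k k' P0 kk'.
exists (\prod_(0 <= q < k) P0 (inord q)), (\prod_(k'.+1 <= q < n.+1) P0 (inord q)) => P hP.
have -> : \prod_q P q = \prod_(0 <= q < n.+1) P (inord q).
  by rewrite big_mkord; apply: eq_bigr => q _; rewrite inord_val.
rewrite (big_cat_nat (leq0n k) (ltnW (ltn_ord k))) (big_ltn (ltn_ord k)) /= -kk'.
rewrite (big_ltn (ltn_ord k')) !inord_val mulrA mulrA -!mulrA; congr (_ * (_ * (_ * _))).
- rewrite big_nat [RHS]big_nat; apply: eq_bigr => q /andP [_ qk].
  have qn : (q < n.+1)%N := ltn_trans qk (ltn_ord k).
  by apply: hP; rewrite -val_eqE /= inordK //; lia.
- rewrite big_nat [RHS]big_nat; apply: eq_bigr => q /andP [qk qn].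
  by apply: hP; rewrite -val_eqE /= inordK //; lia.
Qed.

Lemma prod_mul_comm (D : nzRingType) n (P Q : 'I_n -> D) :
  (forall i j, GRing.comm (Q i) (P j)) -> \prod_i (P i * Q i) = (\prod_i P i) * \prod_i Q i.
Proof.
elim: n P Q => [|n IH] P Q PQ; first by rewrite !big_ord0 mulr1.
rewrite !big_ord_recl IH => [|i j]; last exact: PQ.
rewrite !mulrA; congr (_ * _); rewrite -!mulrA; congr (_ * _).
by apply: commr_prod => i _; apply: PQ.
Qed.

Lemma leibniz_prod (D : nzRingType) n (e : D) (P X Y : 'I_n -> D) (b c : pred 'I_n) :
  (forall q, e * P q - P q * e = (b q)%:R * X q - (c q)%:R * Y q) ->
  e * (\prod_q P q) - (\prod_q P q) * e =
    \sum_(p | b p) \prod_q (if q == p then X q else P q)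
    - \sum_(p | c p) \prod_q (if q == p then Y q else P q).
Proof.
have recl m (P' Z' : 'I_m.+1 -> D) (d : pred 'I_m.+1) :
    \sum_(p | d p) \prod_q (if q == p then Z' q else P' q)
    = (d ord0)%:R * Z' ord0 * \prod_q P' (lift ord0 q)
      + P' ord0 * \sum_(p | d (lift ord0 p))
          \prod_q (if q == p then Z' (lift ord0 q) else P' (lift ord0 q)).
  rewrite big_mkcond big_ord_recl; congr (_ + _).
    case: (d ord0); last by rewrite !mul0r.
    by rewrite mul1r big_ord_recl eqxx; congr (_ * _); apply: eq_bigr.
  rewrite mulr_sumr [RHS]big_mkcond; apply: eq_bigr => p _; case: ifP => // _.
  by rewrite big_ord_recl; congr (_ * _).
elim: n P X Y b c => [|m IH] P X Y b c h.
  by rewrite !big_ord0 mulr1 mul1r !subrr.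
rewrite !recl !big_ord_recl opprD addrACA -mulrBl -h.
rewrite -mulrBr -IH; last by move=> q; apply: h.
by rewrite mulrBl mulrBr !mulrA addrA subrK.
Qed.

Section GenericQdet.
Variables (D : nzRingType) (n : nat) (F : 'I_n -> 'I_n -> 'I_n -> D).
Hypothesis two_regular : forall x : D, x + x = 0 -> x = 0.

(** A column determinant with rows relabelled by [f] and columns by [g]. The position [k] also
    selects the spectral shift, so the order of the factors never changes. *)
Definition qminor (f g : 'I_n -> 'I_n) : D :=
  \sum_(s : 'S_n) (-1) ^+ odd_perm s * \prod_k F k (f (s k)) (g k).

Lemma qminor_ext f f' g g' : f =1 f' -> g =1 g' -> qminor f g = qminor f' g'.
Proof.
by move=> hf hg; apply: eq_bigr => s _; congr (_ * _); apply: eq_bigr => k _; rewrite hf hg.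
Qed.

(** Antisymmetry in the rows is built into the sum: the terms of [s] and [s * tperm k l] cancel. *)
Lemma qminor_row0 f g k l : k != l -> f k = f l -> qminor f g = 0.
Proof.
move=> kl fkl; apply: two_regular.
have inv : injective (fun s : 'S_n => (s * tperm k l)%g) by apply: mulIg.
rewrite {2}/qminor (reindex_inj inv) -big_split big1 // => s _ /=.
rewrite odd_permM odd_tperm kl addbT signrN.
have -> : \prod_q F q (f ((s * tperm k l)%g q)) (g q) = \prod_q F q (f (s q)) (g q).
  by apply: eq_bigr => q _; rewrite permM; case: tpermP => [->|->|//]; rewrite fkl.
by rewrite mulNr subrr.
Qed.

(** Antisymmetrising two consecutive factors in the rows makes them antisymmetric in the columns
    too: the fusion relation behind the quantum determinant. *)
Hypothesis adj : forall k k' : 'I_n, k' = k.+1 :> nat -> forall i i' j j',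
  F k i j * F k' i' j' - F k i' j * F k' i j' + F k i j' * F k' i' j - F k i' j' * F k' i j = 0.

Lemma qminor_adj f g (k k' : 'I_n) : k' = k.+1 :> nat -> qminor f (g \o tperm k k') = - qminor f g.
Proof.
move=> kk'; apply/eqP; rewrite -addr_eq0; apply/eqP; apply: two_regular.
set X := qminor f (g \o tperm k k') + qminor f g.
have ne : k != k' by rewrite -val_eqE /= kk' ltn_eqF.
have inv : injective (fun s : 'S_n => (tperm k k' * s)%g) by apply: mulgI.
have flip h : qminor f h = \sum_(s : 'S_n)
    (-1) ^+ odd_perm s * - \prod_q F q (f ((tperm k k' * s)%g q)) (h q).
  rewrite /qminor (reindex_inj inv); apply: eq_bigr => s _ /=.
  by rewrite odd_permM odd_tperm ne addTb signrN mulrN mulNr.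
rewrite {2}/X !flip /X /qminor -!big_split big1 // => s _ /=.
rewrite -!mulrDr.
have [pre [suf H]] := prod_split_adj (fun q => F q (f (s q)) (g q)) kk'.
have hq q : q != k -> q != k' -> tperm k k' q = q.
  by move=> h1 h2; rewrite tpermD // eq_sym.
rewrite !H; try by move=> q h1 h2; rewrite ?permM ?(hq q).
rewrite !permM tpermL tpermR -opprD -!mulrDl -!mulrDr -mulrBl -mulrBr.
set a := F k _ _ * _; set b := F k _ _ * _; set c := F k _ _ * _; set d := F k _ _ * _.
have -> : a + b - (c + d) = b - d + a - c.
  by rewrite opprD addrA (addrC a) addrAC -!addrA; congr (_ + _); rewrite addrCA addrC -!addrA.
by rewrite adj // mulr0 mul0r mulr0.
Qed.

(** Induction on the distance: with m = b - 1, the transposition (a b) is the shorter (a m)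
    conjugated by the adjacent (m b). *)
Lemma qminor_tperm f g (i j : 'I_n) : i != j -> qminor f (g \o tperm i j) = - qminor f g.
Proof.
have lt_case d : forall g (i j : 'I_n), j = (i + d).+1 :> nat ->
    qminor f (g \o tperm i j) = - qminor f g.
  elim: d => [|d IH] h a b ab; first by apply: qminor_adj; rewrite ab addn0.
  have mn : ((a + d).+1 < n)%N by have := ltn_ord b; lia.
  pose m := Ordinal mn.
  have am : a != m by rewrite -val_eqE /= neq_ltn; apply/orP; left; lia.
  have ab' : a != b by rewrite -val_eqE /= neq_ltn; apply/orP; left; lia.
  have E : tperm a b = (tperm m b * tperm a m * tperm m b)%g.
    by rewrite -{1}[tperm m b]tpermV -mulgA -/(conjg _ _) tpermJ tpermL tpermD // eq_sym.
  have bm : b = m.+1 :> nat by rewrite /= ab; lia.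
  transitivity (qminor f (((h \o tperm m b) \o tperm a m) \o tperm m b)).
    by apply: qminor_ext => // q; rewrite /= E !permM.
  by rewrite (qminor_adj _ _ bm) (IH _ a m) // (qminor_adj _ _ bm) opprK.
move=> ij; case: (ltngtP i j) => h.
- by apply: (lt_case (j - i.+1)%N); lia.
- by rewrite tpermC; apply: (lt_case (i - j.+1)%N); lia.
- by move: ij; rewrite -val_eqE /= h eqxx.
Qed.

Lemma qminor_perm f g (s : 'S_n) : qminor f (g \o s) = (-1) ^+ odd_perm s * qminor f g.
Proof.
have [ts -> h] := prod_tpermP s.
elim: ts h g => [|[a b] ts IH] /= h g.
  rewrite big_nil odd_perm1 mul1r; apply: qminor_ext => // q /=; by rewrite perm1.
have /andP [ab hts] := h.
rewrite big_cons odd_permM odd_tperm ab addTb signrN mulNr -IH // -(qminor_tperm _ _ ab).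
by apply: qminor_ext => // q; rewrite /= permM.
Qed.

Lemma qminor_col0 f g k l : k != l -> g k = g l -> qminor f g = 0.
Proof.
move=> kl gkl; apply: two_regular; rewrite -{1}[qminor f g]opprK -(qminor_tperm f g kl).
rewrite (@qminor_ext f f (g \o tperm k l) g) ?addNr // => q /=.
by case: tpermP => [->|->|//]; rewrite gkl.
Qed.

(** The commutator with [e] is the determinant with row [l] replaced by row [k], minus the one with
    column [k] replaced by column [l]. For [k != l] both have a repetition and vanish; for [k = l]
    they cancel. *)
Lemma qminor_derivation (e : D) (k l : 'I_n) :
  (forall q i j, e * F q i j - F q i j * e = (l == i)%:R * F q k j - (k == j)%:R * F q i l) ->
  e * qminor id id = qminor id id * e.
Proof.
move=> he; apply/eqP; rewrite -subr_eq0; apply/eqP.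
pose f x := if x == l then k else x.
pose g x := if x == k then l else x.
transitivity (qminor f id - qminor id g).
  rewrite /qminor mulr_sumr mulr_suml -!sumrB; apply: eq_bigr => s _ /=.
  rewrite mulrA (commr_sign e) -!mulrA -!mulrBr; congr (_ * _).
  rewrite (leibniz_prod (b := fun q => l == s q) (c := fun q => k == q)
    (X := fun q => F q k q) (Y := fun q => F q (s q) l)) //; congr (_ - _).
    rewrite (big_pred1 ((s^-1)%g l)); last first.
      by move=> p /=; rewrite eq_sym -(inj_eq (@perm_inj _ s) p) permKV.
    by apply: eq_bigr => q _; rewrite /f -(inj_eq (@perm_inj _ s) q) permKV; case: eqP.
  rewrite (big_pred1 k); last by move=> p /=; rewrite eq_sym.
  by apply: eq_bigr => q _; rewrite /g; case: eqP.
have [kl|kl] := eqVneq k l.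
  apply/eqP; rewrite subr_eq0; apply/eqP; apply: qminor_ext => x; rewrite /f /g /= kl.
    by case: eqP.
  by case: eqP.
rewrite (@qminor_row0 f id k l kl) ?(@qminor_col0 id g k l kl) ?subrr // /f /g.
  by rewrite eqxx; case: eqP.
by rewrite eqxx (negbTE kl).
Qed.

End GenericQdet.

(** As for ordinary determinants, expand over all maps [g]: a map that is not injective repeats a
    column of [FL], and a permutation contributes its sign. *)
Lemma qminor_mul (D : nzRingType) (n : nat) (FL FM : 'I_n -> 'I_n -> 'I_n -> D) :
  (forall x : D, x + x = 0 -> x = 0) ->
  (forall k k' : 'I_n, k' = k.+1 :> nat -> forall i i' j j',
    FL k i j * FL k' i' j' - FL k i' j * FL k' i j' + FL k i j' * FL k' i' j
    - FL k i' j' * FL k' i j = 0) ->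
  (forall k i j k' i' j', GRing.comm (FM k i j) (FL k' i' j')) ->
  qminor (fun k i j => \sum_c FL k i c * FM k c j) id id = qminor FL id id * qminor FM id id.
Proof.
move=> two adj LM.
transitivity (\sum_(g : {ffun 'I_n -> 'I_n}) qminor FL id g * \prod_k FM k (g k) k).
  rewrite /qminor; under eq_bigr => s _ do rewrite bigA_distr_bigA mulr_sumr.
  rewrite exchange_big; apply: eq_bigr => g _; rewrite mulr_suml; apply: eq_bigr => s _ /=.
  by rewrite prod_mul_comm ?mulrA.
rewrite (bigID (fun g : {ffun 'I_n -> 'I_n} => injectiveb g)) /= addrC big1 ?add0r; last first.
  by move=> g /injectivePn [i1 [i2 Di12 Ef12]]; rewrite (qminor_col0 two adj _ Di12) ?mul0r.
rewrite (reindex (@pval _)) /=; last first.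
  pose in_Sn := insubd (1%g : 'S_n).
  by exists in_Sn => /= f Uf; first apply: val_inj; apply: insubdK.
rewrite {3}/qminor mulr_sumr; apply: eq_big => /= [s | s _]; rewrite ?(valP s) //.
rewrite mulrA (commr_sign (qminor FL id id)) -(qminor_perm two adj).
congr (_ * _); first by apply: qminor_ext => // q; rewrite pvalE.
by apply: eq_bigr => k _; rewrite pvalE.
Qed.

(** * Substitution into power series *)

Notation fps_scalar B := (fps_map (@GRing.in_alg _ B)).

Section Substitution.
Variables (K : comNzRingType) (B : algType K) (psi : fps K).
Hypothesis psi0 : psi 0%N = 0.

Definition fps_subst (f : fps B) : fps B :=
  fun m => \sum_(r < m.+1) (powS psi r m) *: f r.

Lemma powS_small r m : (m < r)%N -> (psi ^+ r) m = 0.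
Proof.
elim: r m => // r IH m mr; rewrite exprS fpsM /mulS big1 // => -[[|i] im] _ /=.
  by rewrite psi0 mul0r.
by rewrite IH ?mulr0 //; lia.
Qed.

Lemma fps_substE f m M : (m <= M)%N ->
  fps_subst f m = \sum_(r < M.+1) (psi ^+ r) m *: f r.
Proof.
move=> mM; rewrite (big_ord_widen M.+1 (fun r => (psi ^+ r) m *: f r)) //.
have -> : fps_subst f m = \sum_(r < m.+1) (psi ^+ r) m *: f r.
  by apply: eq_bigr => r _; rewrite powSE.
rewrite (big_ord_widen M.+1 (fun r => (psi ^+ r) m *: f r)) // big_mkcond [RHS]big_mkcond.
apply: eq_bigr => r _; rewrite ltn_ord.
by case: ltnP => // h; rewrite powS_small ?scale0r.
Qed.

Lemma fps_substD f g : fps_subst (f + g) = fps_subst f + fps_subst g.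
Proof.
apply: funext => m; rewrite fpsD -big_split; apply: eq_bigr => r _ /=.
by rewrite fpsD scalerDr.
Qed.

Lemma fps_subst_sum I (r : seq I) (F : I -> fps B) :
  fps_subst (\sum_(i <- r) F i) = \sum_(i <- r) fps_subst (F i).
Proof.
apply: (big_morph fps_subst); first exact: fps_substD.
by apply: funext => m; rewrite /fps_subst big1 // => i _; rewrite scaler0.
Qed.

(** Both sides are the double sum of psi^(p+q) f_p g_q. *)
Lemma fps_substM f g : fps_subst (f * g) = fps_subst f * fps_subst g.
Proof.
apply: funext => m.
transitivity (\sum_(p < m.+1) \sum_(q < m.+1) (psi ^+ (p + q)) m *: (f p * g q)).
  rewrite (fps_substE _ (leqnn m)).
  transitivity (\sum_(r < m.+1) \sum_(p < m.+1) \sum_(q < m.+1)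
      if (p + q == r)%N then (psi ^+ (p + q)) m *: (f p * g q) else 0).
    apply: eq_bigr => r _; rewrite fpsM /mulS scaler_sumr.
    rewrite (big_ord_widen m.+1 (fun p => (psi ^+ r) m *: (f p * g (r - p)%N))) //.
    rewrite big_mkcond; apply: eq_bigr => p _.
    case: ltnP => pr.
      have rp : (r - p < m.+1)%N by have := ltn_ord r; lia.
      rewrite (bigD1 (Ordinal rp)) //= subnKC // eqxx big1 ?addr0 // => q.
      rewrite -val_eqE /= => qrp; case: eqP => // pq.
      by rewrite -pq addKn eqxx in qrp.
    by rewrite big1 // => q _; case: eqP => // pq; lia.
  rewrite exchange_big; apply: eq_bigr => p _; rewrite exchange_big; apply: eq_bigr => q _ /=.
  case: (ltnP (p + q) m.+1) => pq; last first.
    by rewrite powS_small ?scale0r ?big1 // => r _; case: eqP.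
  by rewrite (bigD1 (Ordinal pq)) //= eqxx big1 ?addr0 // => r; rewrite -val_eqE /= eq_sym => /negbTE ->.
rewrite fpsM /mulS.
transitivity (\sum_(i < m.+1) \sum_(p < m.+1) \sum_(q < m.+1)
    ((psi ^+ p) i * (psi ^+ q) (m - i)%N) *: (f p * g q)).
  rewrite [RHS]exchange_big; apply: eq_bigr => p _.
  rewrite [RHS]exchange_big; apply: eq_bigr => q _ /=.
  by rewrite exprD fpsM /mulS scaler_suml.
apply: eq_bigr => i _; rewrite (@fps_substE _ _ m) -1?ltnS // (@fps_substE _ _ m) ?leq_subr //.
rewrite mulr_suml; apply: eq_bigr => p _; rewrite mulr_sumr; apply: eq_bigr => q _.
by rewrite -scalerAl -scalerAr scalerA.
Qed.

Lemma fps_substX : fps_subst (fpsX B) = fun m => (psi m)%:A.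
Proof.
apply: funext => -[|m]; first by rewrite /fps_subst big_ord1 /= scaler0 psi0 scale0r.
rewrite (@fps_substE _ _ m.+1) // 2!big_ord_recl big1 => [|i _]; last first.
  by rewrite scaler0.
by rewrite addr0 /= scaler0 add0r expr1.
Qed.

Lemma fps_scalar_comm (h : fps K) (f : fps B) : GRing.comm (fps_scalar B h) f.
Proof.
by apply: fps_commP => a b; rewrite /fps_map /= -scalerAl -scalerAr mul1r mulr1.
Qed.

End Substitution.

Section SeriesRegular.
Variable K : comNzRingType.

Lemma fps_unit_regular (u f : fps K) : u 0%N = 1 -> u * f = 0 -> f = 0.
Proof.
move=> u0 uf; apply: funext; elim/ltn_ind => m IH.
have := congr1 (fun g : fps K => g m) uf; rewrite /= fpsM /mulS big_ord_recl /= u0 mul1r subn0.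
rewrite big1 ?addr0 // => i _; rewrite IH ?mulr0 //.
by rewrite /bump /=; have := ltn_ord i; lia.
Qed.

Lemma fpsX_regular (f : fps K) : fpsX K * f = 0 -> f = 0.
Proof.
rewrite fpsXM => h; apply: funext => m.
exact: (congr1 (fun g : fps K => g m.+1) h).
Qed.

End SeriesRegular.

(** * Solutions with one site *)

Section SiteSeries.
Variables (R : realType) (beta : R[i]).
Local Notation C := (R[i]).

(** The recursion has order two, so two consecutive coefficients are carried along. *)
Fixpoint site_coef2 (a : C) (r : nat) : C * C :=
  if r is r'.+1 then let: (p, q) := site_coef2 a r' in (q, a * q - beta * p) else (0, 1).
(* Coefficients of 1 / (u + beta/u - a). *)
Definition site_coef (a : C) : nat -> C := fun r => (site_coef2 a r).1.

Lemma site_coefS a r :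
  site_coef a r.+2 = a * site_coef a r.+1 - beta * site_coef a r.
Proof. by rewrite /site_coef /=; case: (site_coef2 a r). Qed.

Local Notation w := (fpsX C : fps C).
Local Notation "c %:S" := (fpsC c : fps C) (at level 2).

Lemma site_coef_den a :
  (site_coef a : fps C) * (1 + beta%:S * w ^+ 2 - a%:S * w) = w.
Proof.
set f : fps C := site_coef a.
have -> : f * (1 + beta%:S * w ^+ 2 - a%:S * w) = f + beta%:S * (w * (w * f)) - a%:S * (w * f).
  by ring.
apply: funext => m; rewrite !(fpsD, fpsN) !fpsCM !fpsXM.
case: m => [|[|m]] /=; rewrite ?fpsXM /=; try by rewrite /f /site_coef /oneS /=; ring.
by rewrite /f site_coefS /oneS /=; ring.
Qed.

Variable psi : C -> nat -> C.
Hypothesis psiP : forall c, phi_inv_spec beta c (psi c).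

Let psi0 c : psi c 0%N = 0. Proof. by case: (psiP c). Qed.

Definition site_subst (c a : C) : fps C :=
  fun m => \sum_(r < m.+1) powS (psi c) r m * site_coef a r.

(** This is w (u + beta/u + c - a). *)
Definition site_den (c a : C) : fps C := 1 + beta%:S * w ^+ 2 + (c - a)%:S * w.

Lemma site_den0 c a : site_den c a 0%N = 1.
Proof.
by rewrite /site_den expr2 !fpsD !fpsCM !fpsXM /= !mulr0 !addr0.
Qed.

(* Composing with phi_c shifts u + beta/u by c. *)
Lemma site_subst_den c a : site_subst c a * site_den c a = w.
Proof.
pose ps : fps C := psi c.
have spec : w + beta%:S * (w * ps ^+ 2) = ps + beta%:S * (w ^+ 2 * ps) + c%:S * (w * ps).
  apply: funext => m; have [_ _ /(_ m)] := psiP c.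
  by rewrite !fpsD !fpsCM !expr2 -mulrA !fpsXM.
have sub : site_subst c a * (1 + beta%:S * ps ^+ 2 - a%:S * ps) = ps.
  pose sb (f : fps C) : fps C := @fps_subst C C^o ps f.
  have sM (f g : fps C) : sb (f * g) = sb f * sb g.
    by apply: (@fps_substM C C^o); apply: psi0.
  have sC (d : C) : sb (d%:S) = d%:S.
    apply: funext => m; rewrite /sb /fps_subst big_ord_recl big1 => [|i _]; last first.
      by rewrite scaler0.
    by rewrite addr0 /= /oneS; case: m => [|m] /=; rewrite ?scale1r ?scale0r.
  have sD (f g : fps C) : sb (f + g) = sb f + sb g by apply: (@fps_substD C C^o).
  have sX : sb w = ps.
    apply: etrans (fps_substX C^o (psi0 c)) _.
    by apply: funext => m; apply: mulr1.
  have := congr1 sb (site_coef_den a); rewrite sM sX.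
  have -> : (1 : fps C) = 1%:S by rewrite rmorph1.
  rewrite -mulNr -rmorphN !sD !expr2 !sM !sC !sX => E; rewrite -[RHS]E; congr (_ * _).
  by rewrite rmorphN mulNr.
(* The sides are compared after multiplication by [ps], which is [w] times a unit; [spec] then
   trades the denominator in [ps] for [site_den]. *)
have key : w * ((site_subst c a * site_den c a - w)) = 0.
  pose u : fps C := fun m => ps m.+1.
  have psE : ps = w * u.
    by rewrite fpsXM; apply: funext => -[|m] //=; rewrite /ps psi0.
  have u0 : u 0%N = 1 by case: (psiP c).
  apply: (fps_unit_regular u0); rewrite mulrA (mulrC u) -psE /site_den rmorphB.
  have -> : ps * (site_subst c a * (1 + beta%:S * w ^+ 2 + (c%:S - a%:S) * w) - w)
    = site_subst c a * (ps + beta%:S * (w ^+ 2 * ps) + c%:S * (w * ps) - a%:S * w * ps)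
      - w * ps by ring.
  rewrite -spec -{3}sub; ring.
apply/eqP; rewrite -subr_eq0; apply/eqP; exact: fpsX_regular key.
Qed.

(** The resolvent identity 1/(y - 1) - 1/y = 1/(y (y - 1)) for y = u + beta/u + c - a, checked after
    clearing denominators. *)
Lemma site_subst_shift c a :
  site_subst (c - 1) a - site_subst c a = site_subst c a * site_subst (c - 1) a.
Proof.
apply/eqP; rewrite -subr_eq0; apply/eqP.
apply: (fps_unit_regular (site_den0 c a)); apply: (fps_unit_regular (site_den0 (c - 1) a)).
have h := site_subst_den c a; have h' := site_subst_den (c - 1) a.
set s := site_subst c a in h *; set s' := site_subst (c - 1) a in h' *.
have hd : site_den (c - 1) a = site_den c a - w.
  by rewrite /site_den !rmorphB rmorph1; ring.
set q := site_den c a in h hd *; set q' := site_den (c - 1) a in h' hd *.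
have -> : q' * (q * (s' - s - s * s')) = q * (s' * q') - q' * (s * q) - (s * q) * (s' * q').
  by ring.
by rewrite h h' hd; ring.
Qed.

End SiteSeries.

Lemma alternating_sum_split (V : zmodType) (a b a' b' a'' b'' a3 b3 : V) :
  (a + b) - (a' + b') + (a'' + b'') - (a3 + b3) = (a - a' + a'' - a3) + (b - b' + b'' - b3).
Proof.
by rewrite !opprD [a + b + _]addrACA [_ + (a'' + b'')]addrACA [LHS]addrACA.
Qed.

Section SiteAlgebra.
Variables (D : nzRingType) (n : nat) (h h' : D) (e : 'I_n -> 'I_n -> D).
Hypothesis hC' : forall x, GRing.comm h' x.
Hypothesis hh : h' - h = h * h'.
Hypothesis e_gl : forall i j k l,
  e i j * e k l - e k l * e i j = (k == j)%:R * e i l - (i == l)%:R * e k j.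

(** The constant parts cancel. The bracket [e_gl] makes the part with [h * h'] linear in [e], and
    [hh] balances it against the linear parts with [h] and [h']. *)
Lemma site_adj i i' j j' :
  let F i j := (i == j)%:R + h * e i j in let F' i j := (i == j)%:R + h' * e i j in
  F i j * F' i' j' - F i' j * F' i j' + F i j' * F' i' j - F i' j' * F' i j = 0.
Proof.
move=> F F'.
have expand a b c d : F a b * F' c d = ((a == b)%:R * (c == d)%:R + h * ((c == d)%:R * e a b))
    + (h' * ((a == b)%:R * e c d) + h * h' * (e a b * e c d)).
  rewrite /F /F' mulrDl !mulrDr -!addrA; congr (_ + _).
  rewrite addrCA; congr (_ + (_ + _)).
  - by rewrite -mulrA commr_nat.
  - by rewrite mulrA -commr_nat mulrA.
  - by rewrite -!mulrA; congr (_ * _); rewrite mulrA -(hC' (e a b)) mulrA.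
rewrite !expand !alternating_sum_split.
have -> : (i == j)%:R * (i' == j')%:R - (i' == j)%:R * (i == j')%:R
    + (i == j')%:R * (i' == j)%:R - (i' == j')%:R * (i == j)%:R = 0 :> D.
  by rewrite [_ * (i' == j)%:R]commr_nat subrK commr_nat subrr.
rewrite add0r -!mulrBr -!mulrDr -!mulrBr.
have -> : e i j * e i' j' - e i' j * e i j' + e i j' * e i' j - e i' j' * e i j
  = (i' == j)%:R * e i j' - (i == j')%:R * e i' j
    + ((i' == j')%:R * e i j - (i == j)%:R * e i' j').
  rewrite -!e_gl.
  by rewrite -[LHS]addrA [X in _ + X]addrC addrACA; congr (_ + _); apply: addrC.
set a := _ * e i j; set b := _ * e i' j; set c := _ * e i j'; set d := _ * e i' j'.
have -> : c - b + (a - d) = a - b + c - d.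
  by rewrite addrACA [a - b + c]addrAC -[RHS]addrA (addrC c).
have -> : d - c + b - a = - (a - b + c - d).
  by rewrite opprB opprD opprB -addrA -addrA (addrC (- c)).
by rewrite -hh mulrN mulrBl addKr subrr.
Qed.

End SiteAlgebra.

Section SiteQdet.
Variables (R : realType) (n : nat) (beta : R[i]) (B : algType R[i]).
Local Notation C := (R[i]).
Variable psi : C -> nat -> C.
Hypothesis psiP : forall c, phi_inv_spec beta c (psi c).

Let psi0 c : psi c 0%N = 0. Proof. by case: (psiP c). Qed.

Lemma fps_two_regular (x : fps B) : x + x = 0 -> x = 0.
Proof.
move=> xx; apply: funext => m; have E : (2%:R : C) *: x m = 0 by rewrite scaler_nat mulr2n -fpsD xx.
have two : (2%:R : C) != 0 by rewrite Num.Theory.pnatr_eq0.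
by rewrite -[x m]scale1r -(mulVf two) -scalerA E scaler0.
Qed.

Implicit Types t s : 'I_n -> 'I_n -> nat -> B.

Definition qfactor (t : 'I_n -> 'I_n -> nat -> B) (k i j : 'I_n) : fps B :=
  fps_subst (psi (- k%:R)) (tser t i j).

Lemma qdetE t : qdet psi t = qminor (qfactor t) id id.
Proof.
apply: funext => m; rewrite /qdet /qminor fps_sum; apply: eq_bigr => s _.
case: (odd_perm s); last by rewrite !expr0 scale1r mul1r.
by rewrite !expr1 scaleN1r mulN1r.
Qed.

Definition qdet_central (t : 'I_n -> 'I_n -> nat -> B) := forall i j r m,
  t i j r.+1 * qdet psi t m = qdet psi t m * t i j r.+1 :> B.

Section OneSite.
Variables (a : C) (E : 'I_n -> 'I_n -> B).
Hypothesis E_gl : forall i j k l,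
  commA (E i j) (E k l) = (k == j)%:R * E i l - (i == l)%:R * E k j.

Definition site_t (i j : 'I_n) (r : nat) : B := site_coef beta a r *: E i j.

Lemma tcoef_site i j r : (0 < r)%N -> tcoef site_t i j r = site_coef beta a r *: E i j.
Proof. by case: r. Qed.

Lemma OY_rel_site : OY_rel beta site_t.
Proof.
move=> i j k l p q.
have XE p' q' : commA (tcoef site_t i j p') (tcoef site_t k l q')
    = (site_coef beta a p' * site_coef beta a q') *: commA (E i j) (E k l).
  case: p' => [|p']; first by rewrite commA_tcoef0l mul0r scale0r.
  case: q' => [|q']; first by rewrite commA_tcoef0r mulr0 scale0r.
  by rewrite /commA -!scalerAl -!scalerAr !scalerA scalerBr (mulrC (site_coef _ _ q'.+1)).
have c0 : site_coef beta a 0 = 0 by [].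
have c1 : site_coef beta a 1 = 1 by [].
move=> X; rewrite /X; case: p => [|p]; case: q => [|q]; rewrite !XE ?c0 ?c1 ?mul0r ?mulr0
  ?scale0r ?scaler0 ?mul1r ?mulr1 ?addr0 ?subr0 ?sub0r.
- by rewrite subrr.
- by rewrite E_gl !tcoef0 !tcoef_site // -!scalerAl -!scalerAr !mul1r !mulr1 scalerBr
    !scaler_nat !mulr_natl !scalerMnr.
- by rewrite E_gl !tcoef0 !tcoef_site // -!scalerAl -!scalerAr !mul1r !mulr1 scalerBr opprB
    !scaler_nat !mulr_natl !scalerMnr.
(* Both sides vanish. Writing c_p for [site_coef beta a p], the recursion gives c_(p+2) + beta c_p =
   a c_(p+1), so the left side is a difference of two equal terms. *)
- rewrite !tcoef_site // -!scalerAl -!scalerAr !scalerA -!scalerDl -!scalerBl.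
  rewrite !site_coefS [X in X *: commA _ _](_ : _ = 0); last by ring.
  by rewrite [X in _ = X *: _](_ : _ = 0) ?scale0r //; ring.
Qed.

Lemma qfactor_site k i j : qfactor site_t k i j
  = (i == j)%:R + fps_scalar B (site_subst beta psi (- k%:R) a) * fpsC (E i j).
Proof.
apply: funext => m; rewrite fpsD fpsMC /fps_map /= -(rmorph_nat (@fpsC B)).
rewrite /qfactor /fps_subst /site_subst big_ord_recl [X in X%:A]big_ord_recl.
rewrite [X in X + \sum_(_ < _) _ * _]mulr0 add0r -scalerAl mul1r scaler_suml; congr (_ + _).
  by rewrite /= /oneS; case: m => [|m] /=; rewrite ?scale1r ?scale0r.
by apply: eq_bigr => r _; rewrite /tser tcoef_site // scalerA.
Qed.

Let gl i j k l : fpsC (E i j) * fpsC (E k l) - fpsC (E k l) * fpsC (E i j)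
    = (k == j)%:R * fpsC (E i l) - (i == l)%:R * fpsC (E k j).
Proof.
by rewrite -!rmorphM -rmorphB -[_ - _]/(commA _ _) E_gl rmorphB !rmorphM !rmorph_nat.
Qed.

Lemma qfactor_site_adj (k k' : 'I_n) : k' = k.+1 :> nat -> forall i i' j j',
  let F := qfactor site_t in
  F k i j * F k' i' j' - F k i' j * F k' i j' + F k i j' * F k' i' j - F k i' j' * F k' i j = 0.
Proof.
move=> kk' i i' j j'; rewrite /= !qfactor_site.
apply: (@site_adj _ _ _ _ (fun i j => fpsC (E i j))).
- by move=> x; apply: fps_scalar_comm.
- rewrite -rmorphB -rmorphM; congr (fps_map _ _).
  have -> : - k'%:R = - k%:R - 1 :> C by rewrite kk' -addn1 natrD opprD.
  exact: site_subst_shift.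
- exact: gl.
Qed.

(** The factors are combinations of the identity and [E] with scalar series as coefficients, so
    bracketing with E_kl acts on each by the adjoint action and [qminor_derivation] applies. *)
Lemma qdet_central_site : qdet_central site_t.
Proof.
suff H k l : fpsC (E k l) * qminor (qfactor site_t) id id
           = qminor (qfactor site_t) id id * fpsC (E k l).
  move=> i j r m; rewrite qdetE /site_t -scalerAl -scalerAr; congr (_ *: _).
  by have := congr1 (fun f : fps B => f m) (H i j); rewrite /= fpsCM fpsMC.
apply: (@qminor_derivation _ n (qfactor site_t) fps_two_regular _ _ k l).
- exact: qfactor_site_adj.
- move=> q i j; rewrite !qfactor_site; set h := fps_map _ _.
  have hC x : GRing.comm h x by apply: fps_scalar_comm.
  rewrite !mulrDr mulrDl commr_nat opprD addrACA subrr add0r.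
  rewrite mulrA -(hC (fpsC (E k l))) -!mulrA -mulrBr gl opprD addrACA.
  rewrite [X in _ = X + _](_ : _ = 0) ?add0r.
    by rewrite mulrBr !mulrA !(commr_nat h) (eq_sym l).
  by rewrite commr_nat (eq_sym l) subrr.
Qed.
End OneSite.

Lemma qfactor_tmul t s k i j :
  qfactor (tmul t s) k i j = \sum_c qfactor t k i c * qfactor s k c j.
Proof.
rewrite /qfactor tser_tmul fps_subst_sum; apply: eq_bigr => c _.
by apply: fps_substM; apply: psi0.
Qed.

Lemma qfactor_comm_elt t x : (forall i j r, x * t i j r = t i j r * x) ->
  forall k i j m, x * qfactor t k i j m = qfactor t k i j m * x.
Proof.
move=> h k i j m; rewrite /qfactor /fps_subst mulr_sumr mulr_suml; apply: eq_bigr => r _.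
rewrite -scalerAl -scalerAr; congr (_ *: _); rewrite /tser.
by case: (val r) => [|r'] /=; rewrite ?h // commr_nat.
Qed.

Lemma qdet_comm_elt t x : (forall i j r, x * t i j r = t i j r * x) ->
  forall m, x * qdet psi t m = qdet psi t m * x.
Proof.
move=> h m; rewrite qdetE; have H : GRing.comm (fpsC x) (qminor (qfactor t) id id).
  apply: commr_sum => s _; apply: commrM; first exact: commr_sign.
  apply: commr_prod => k _; apply: fpsC_comm => m'; exact: qfactor_comm_elt.
by have := congr1 (fun f : fps B => f m) H; rewrite /= fpsCM fpsMC.
Qed.

Section TwoFactors.
Variables t s : 'I_n -> 'I_n -> nat -> B.
Hypothesis ts : forall i j r i' j' r', t i j r * s i' j' r' = s i' j' r' * t i j r.
Hypothesis t_adj : forall k k' : 'I_n, k' = k.+1 :> nat -> forall i i' j j',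
  let F := qfactor t in
  F k i j * F k' i' j' - F k i' j * F k' i j' + F k i j' * F k' i' j - F k i' j' * F k' i j = 0.

Lemma qdet_tmul : (qdet psi (tmul t s) : fps B) = (qdet psi t : fps B) * qdet psi s.
Proof.
rewrite !qdetE -qminor_mul //; last 2 first.
- exact: fps_two_regular.
- move=> k i j k' i' j'; apply: fps_commP => a b.
  apply: esym; apply: qfactor_comm_elt => i2 j2 r2; apply: esym.
  by apply: qfactor_comm_elt => i3 j3 r3; rewrite ts.
apply: eq_bigr => p _; congr (_ * _); apply: eq_bigr => k _; exact: qfactor_tmul.
Qed.

(** By multiplicativity it suffices to commute with both determinants: entries of [t] commute with
    that of [t] by assumption and with that of [s] because they commute with [s]; likewise for
    entries of [s]. *)
Lemma qdet_central_tmul : qdet_central t -> qdet_central s -> qdet_central (tmul t s).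
Proof.
move=> ht hs i j r m.
have comm_coef (x : B) : (forall m, x * qdet psi t m = qdet psi t m * x) ->
    (forall m, x * qdet psi s m = qdet psi s m * x) ->
    x * qdet psi (tmul t s) m = qdet psi (tmul t s) m * x.
  move=> h1 h2; have H : GRing.comm (fpsC x) ((qdet psi t : fps B) * qdet psi s).
    by apply: commrM; apply: fpsC_comm.
  by have := congr1 (fun f : fps B => f m) H; rewrite /= fpsCM fpsMC -qdet_tmul.
have key c a : tser t i c a * qdet psi (tmul t s) m = qdet psi (tmul t s) m * tser t i c a.
  case: a => [|a]; first by rewrite /tser /= commr_nat.
  apply: comm_coef; first by move=> m'; apply: ht.
  by apply: qdet_comm_elt => i' j' r'; apply: ts.
have key' c a : tser s c j a * qdet psi (tmul t s) m = qdet psi (tmul t s) m * tser s c j a.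
  case: a => [|a]; first by rewrite /tser /= commr_nat.
  apply: comm_coef; last by move=> m'; apply: hs.
  by apply: qdet_comm_elt => i' j' r'; apply/esym/ts.
rewrite /tmul fps_sum mulr_suml mulr_sumr; apply: eq_bigr => c _.
rewrite fpsM /mulS mulr_suml mulr_sumr; apply: eq_bigr => a _.
by rewrite -mulrA key' mulrA key mulrA.
Qed.
End TwoFactors.

End SiteQdet.

(** * Oscillator representations *)

(** Put both products in normal order: the quartic terms agree and only the contractions remain. *)
Lemma weyl_gl (D : nzRingType) (I : eqType) (X Y : I -> D) :
  (forall a b, X a * X b = X b * X a) -> (forall a b, Y a * Y b = Y b * Y a) ->
  (forall a b, Y a * X b = X b * Y a + (a == b)%:R) ->
  forall a b c d, (X a * Y b) * (X c * Y d) - (X c * Y d) * (X a * Y b)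
    = (c == b)%:R * (X a * Y d) - (a == d)%:R * (X c * Y b).
Proof.
move=> XX YY YX a b c d.
have step a' b' c' d' : (X a' * Y b') * (X c' * Y d')
    = X a' * X c' * (Y b' * Y d') + (b' == c')%:R * (X a' * Y d').
  rewrite -!mulrA (mulrA (Y b')) YX mulrDl mulrDr !mulrA; congr (_ + _).
  by rewrite -!mulrA mulrA commr_nat -mulrA.
by rewrite !step (XX c) (YY d) opprD addrACA subrr add0r (eq_sym b) (eq_sym d).
Qed.

Section Operators.
Variables (K : comNzRingType) (I : finType).
(** Exponents take all values in [K] and states are arbitrary functions, so shifts in both
    directions are defined everywhere. *)
Definition lattice := {ffun I -> K}.
Definition state := lattice -> K^o.
Definition step (a : I) : lattice := [ffun b => (b == a)%:R].

Fact const1_neq0 : (fun=> 1 : K^o) != 0 :> state.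
Proof. by apply/eqP => /(congr1 (fun f : state => f 0)) /eqP; rewrite oner_eq0. Qed.

Definition oper := endo_ const1_neq0.
HB.instance Definition _ := GRing.Algebra.on oper.

Fact raise_lin (m : K) (a : I) :
  is_lin (fun f : state => (fun e => m * f e + e a * f (e - step a)) : state).
Proof. by move=> c u v; apply: funext => e; rewrite !fctE /GRing.scale /=; ring. Qed.
Fact lower_lin (m : K) (a : I) :
  is_lin (fun f : state => (fun e => m * f e + f (e + step a)) : state).
Proof. by move=> c u v; apply: funext => e; rewrite !fctE /GRing.scale /=; ring. Qed.
(* The Heisenberg generators on functions of e, shifted by the scalar m. *)
Definition raise m a : oper := Endo const1_neq0 (raise_lin m a).
Definition lower m a : oper := Endo const1_neq0 (lower_lin m a).

Lemma raise_comm m m' a b : raise m a * raise m' b = raise m' b * raise m a.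
Proof.
apply: endo_eq => f; apply: funext => e; rewrite !endoME /= !ffunE.
rewrite [e - _ - step a]addrAC (eq_sym b a).
have E (x y z t p q d : K) : d * p = d * q ->
    m * (m' * x + q * y) + p * (m' * z + (q - d) * t)
    = m' * (m * x + p * z) + q * (m * y + (p - d) * t).
  move=> dd; have h : d * p * t - d * q * t = 0 by rewrite dd subrr.
  by apply/eqP; rewrite -subr_eq0 -[X in _ == X]oppr0 -h; apply/eqP; ring.
by apply: E; case: eqP => [->|_]; rewrite ?mul0r.
Qed.

Lemma lower_comm m m' a b : lower m a * lower m' b = lower m' b * lower m a.
Proof.
apply: endo_eq => f; apply: funext => e; rewrite !endoME /=.
rewrite [e + _ + step a]addrAC.
have E (x y z t : K) : m * (m' * x + y) + (m' * z + t) = m' * (m * x + z) + (m * y + t) by ring.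
exact: E.
Qed.

Lemma lower_raise m m' a b : lower m a * raise m' b = raise m' b * lower m a + (a == b)%:R.
Proof.
apply: endo_eq => f; apply: funext => e; rewrite endoDE !endoME fctE /= !ffunE.
have -> : ((a == b)%:R : oper) f e = (a == b)%:R * f e.
  by rewrite -scaler_nat endoZE endo1E.
rewrite [e + _ - _]addrAC.
have E (x y z t p d d' : K) : d' = d -> d * t = d * x ->
    m * (m' * x + p * y) + (m' * z + (p + d') * t)
    = m' * (m * x + z) + p * (m * y + t) + d * x.
  by move=> -> dd; rewrite -dd; ring.
apply: E; first by rewrite eq_sym.
by case: eqP => [->|_]; rewrite ?mul0r // subrK.
Qed.

End Operators.

Lemma pred_add_le a b p q : (a <= p.+1)%N -> (b <= q.+1)%N -> ((a + b).-1 <= (q + p).+1)%N.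
Proof. by lia. Qed.

(** * Growth of operator families in the parameter *)

Section Orders.
Variables (K : numFieldType) (I : finType).
Local Notation oper := (oper K I).
Local Notation state := (state K I).

Lemma poly_eq0_fun (p : {poly K}) : (forall s, p.[s] = 0) -> p = 0.
Proof.
move=> h; pose rs : seq K := [seq i%:R | i <- iota 0 (size p)].
apply/eqP; apply: contraT => p0.
have urs : uniq rs.
  by rewrite map_inj_uniq ?iota_uniq // => i j /eqP; rewrite Num.Theory.eqr_nat => /eqP.
have := max_poly_roots p0 _ urs; rewrite size_map size_iota ltnn => -> //.
by apply/allP => y _; rewrite /root h.
Qed.

(** The coefficient [g] is the same at every lattice point [e], while the lower ones may vary with
    [e]. *)
Definition vord (q : nat) (g : K) (v : K -> state) : Prop :=
  forall e, exists P : {poly K}, [/\ (size P <= q.+1)%N, P`_q = g & forall s, v s e = P.[s]].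

Lemma vord_D q g g' v v' : vord q g v -> vord q g' v' ->
  vord q (g + g') (fun s => v s + v' s).
Proof.
move=> hv hv' e; have [P [hP <- eP]] := hv e; have [Q [hQ <- eQ]] := hv' e.
exists (P + Q); split; first by apply: leq_trans (size_polyD _ _) _; rewrite geq_max hP hQ.
  by rewrite coefD.
by move=> s; rewrite hornerD -eP -eQ.
Qed.

Lemma vord_lt q q' g v : (q < q')%N -> vord q g v -> vord q' 0 v.
Proof.
move=> qq' hv e; have [P [hP _ eP]] := hv e; exists P; split=> //.
  by apply: leq_trans hP _; lia.
by rewrite nth_default //; apply: leq_trans hP _.
Qed.

Lemma vord_scale q g v (P : {poly K}) d : (size P <= d.+1)%N -> vord q g v ->
  vord (q + d) (P`_d * g) (fun s => P.[s] *: v s).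
Proof.
move=> hP hv e; have [Q [hQ <- eQ]] := hv e; exists (P * Q); split.
- exact: leq_trans (size_polyMleq _ _) (pred_add_le hP hQ).
- rewrite coefM (bigD1 (inord d)) //= inordK; last by lia.
  rewrite addnK big1 ?addr0 // => i ne.
  have ne' : (i : nat) <> d.
    by move=> id; move: ne; rewrite -val_eqE /= inordK ?id ?eqxx //; lia.
  case: (ltnP i d) => id; first by rewrite [Q`_ _]nth_default ?mulr0 //; apply: leq_trans hQ _; lia.
  by rewrite nth_default ?mul0r //; apply: leq_trans hP _; lia.
- by move=> s; rewrite hornerM -eQ.
Qed.

(** Defined by the effect on all [vord] families, so that under composition orders add and leading
    coefficients multiply. *)
Definition ord (p : nat) (g : K) (b : K -> oper) : Prop :=
  forall q h v, vord q h v -> vord (q + p) (g * h) (fun s => b s (v s)).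

Lemma ord_D p g g' b b' : ord p g b -> ord p g' b' -> ord p (g + g') (fun s => b s + b' s).
Proof. by move=> hb hb' q h v hv; rewrite mulrDl; apply: vord_D; [apply: hb | apply: hb']. Qed.

Lemma ord_M p p' g g' b b' : ord p g b -> ord p' g' b' ->
  ord (p + p') (g * g') (fun s => b s * b' s).
Proof.
move=> hb hb' q h v hv; rewrite -mulrA (_ : q + (p + p') = q + p' + p)%N; last by lia.
by apply: hb; apply: hb'.
Qed.

Lemma ord_lt p p' g b : (p < p')%N -> ord p g b -> ord p' 0 b.
Proof.
by move=> pp' hb q h v hv; rewrite mul0r; apply: vord_lt (hb _ _ _ hv); rewrite ltn_add2l.
Qed.

Lemma ord_scale p g b (P : {poly K}) d : (size P <= d.+1)%N -> ord p g b ->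
  ord (p + d) (P`_d * g) (fun s => P.[s] *: b s).
Proof.
move=> hP hb q h v hv; rewrite addnA -mulrA; exact: vord_scale hP (hb _ _ _ hv).
Qed.

Lemma ord_Z p g b c : ord p g b -> ord p (c * g) (fun s => c *: b s).
Proof.
move=> hb; have := @ord_scale p g b c%:P 0%N (size_polyC_leq1 _) hb.
rewrite addn0 coefC eqxx; have -> // : (fun s => c%:P.[s] *: b s) = (fun s => c *: b s).
by apply: funext => s; rewrite hornerC.
Qed.

Lemma ord_0 p : ord p 0 (fun=> 0).
Proof.
move=> q h v hv e; exists 0; split; rewrite ?size_poly0 ?coef0 ?mul0r // => s.
by rewrite horner0.
Qed.

Lemma ord_1 : ord 0 1 (fun=> 1).
Proof. by move=> q h v hv; rewrite addn0 mul1r. Qed.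

Lemma ord_sum J (r : seq J) p (g : J -> K) (b : J -> K -> oper) :
  (forall j, ord p (g j) (b j)) -> ord p (\sum_(j <- r) g j) (fun s => \sum_(j <- r) b j s).
Proof.
move=> h; elim: r => [|j r IH].
  have -> : (fun s => \sum_(j <- [::]) b j s) = (fun=> 0) by apply: funext => s; rewrite big_nil.
  by rewrite big_nil; apply: ord_0.
have -> : (fun s => \sum_(k <- j :: r) b k s) = (fun s => b j s + \sum_(k <- r) b k s).
  by apply: funext => s; rewrite big_cons.
by rewrite big_cons; apply: ord_D.
Qed.

(** The factor [s * c] raises the degree in [s] by one, whereas the shifted term only changes the
    lattice point and stays below. *)
Lemma ord_shift (c : K) a (sg : lattice K I -> lattice K I) (m : lattice K I -> K)
    (b : K -> oper) :
  (forall s f e, b s f e = s * c * f e + m e * f (sg e)) -> a = 1%N -> ord a c b.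
Proof.
move=> hb -> q h v hv e.
have [P [hP <- eP]] := hv e; have [Q [hQ _ eQ]] := hv (sg e).
exists (c *: ('X * P) + m e *: Q); split.
- apply: leq_trans (size_polyD _ _) _; rewrite geq_max; apply/andP; split.
    apply: leq_trans (size_scale_leq _ _) _.
    apply: leq_trans (size_polyMleq _ _) _; rewrite size_polyX.
    exact: (@pred_add_le 2 _ 1%N q).
  by apply: leq_trans (size_scale_leq _ _) _; rewrite addn1; apply: leqW.
- rewrite coefD !coefZ coefXM addn1 /= [Q`_ _]nth_default ?mulr0 ?addr0 //.
- move=> s; rewrite hb eP eQ hornerD !hornerZ hornerM hornerX.
  by rewrite -!mulrA [s * _]mulrCA.
Qed.

Lemma ord_raise c a : ord 1 c (fun s => raise (s * c) a).
Proof. by apply: ord_shift. Qed.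

Lemma ord_lower c a : ord 1 c (fun s => lower (s * c) a).
Proof.
apply: (@ord_shift _ _ (fun e => e + step K a) (fun=> 1)) => // s f e /=.
by rewrite mul1r.
Qed.

(** Test on the constant state 1 at the origin: the value is the zero polynomial in [s], and its
    coefficient at [p] is [g]. *)
Lemma ord_zero p g b : ord p g b -> (forall s, b s = 0) -> g = 0.
Proof.
move=> hb b0.
have h1 : vord 0 1 (fun=> (fun=> 1) : state).
  by move=> e; exists 1; split; rewrite ?size_poly1 ?coefC // => s; rewrite hornerC.
have [P [_ hP eP]] := hb _ _ _ h1 0.
have P0 : P = 0 by apply: poly_eq0_fun => s; rewrite -eP b0.
by rewrite -[g]mulr1 -hP P0 coef0.
Qed.

End Orders.

(** * Representations with several sites *)

Section MultiSite.
Variables (R : realType) (n : nat) (beta : R[i]).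
Local Notation C := (R[i]).
Variable psi : C -> nat -> C.
Hypothesis psiP : forall c, phi_inv_spec beta c (psi c).
Variables (J : finType) (al : J -> C) (mu xi : J -> 'I_n -> C).
Local Notation B := (oper C (J * 'I_n)%type).

Definition siteE (s : C) (k : J) (i j : 'I_n) : B :=
  raise (s * mu k i) (k, i) * lower (s * xi k j) (k, j).

Lemma siteE_comm s k k' i j i' j' :
  commA (siteE s k i j) (siteE s k' i' j')
  = ((k', i') == (k, j))%:R * (raise (s * mu k i) (k, i) * lower (s * xi k' j') (k', j'))
    - ((k, i) == (k', j'))%:R * (raise (s * mu k' i') (k', i') * lower (s * xi k j) (k, j)).
Proof.
apply: (@weyl_gl _ _ (fun a => raise (s * mu a.1 a.2) a) (fun a => lower (s * xi a.1 a.2) a)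
  _ _ _ (k, i) (k, j) (k', i') (k', j')) => a b.
- exact: raise_comm.
- exact: lower_comm.
- exact: lower_raise.
Qed.

Lemma siteE_gl s k i j i' j' :
  commA (siteE s k i j) (siteE s k i' j')
  = (i' == j)%:R * siteE s k i j' - (i == j')%:R * siteE s k i' j.
Proof. by rewrite siteE_comm !xpair_eqE eqxx. Qed.

Lemma siteE_comm0 s k k' i j i' j' : k != k' ->
  siteE s k i j * siteE s k' i' j' = siteE s k' i' j' * siteE s k i j.
Proof.
move=> kk'; apply/eqP; rewrite -subr_eq0; apply/eqP; rewrite -[LHS]/(commA _ _) siteE_comm.
by rewrite !xpair_eqE (eq_sym k') (negbTE kk') !mul0r subrr.
Qed.

(* With weight 4 for u + beta/u and 2 for an oscillator pair, t^(r+1) has order 4r + 2 in s,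
   twice the weight of its letter. *)
Definition one_site (s : C) (k : J) := site_t beta (s ^+ 4 * al k) (siteE s k).

Definition sitesT (s : C) (ks : seq J) : 'I_n -> 'I_n -> nat -> B :=
  foldr (fun k t => tmul (one_site s k) t) (fun _ _ _ => 0) ks.

Lemma tmul_comm_elt (t t' : 'I_n -> 'I_n -> nat -> B) x :
  (forall i j r, x * t i j r = t i j r * x) -> (forall i j r, x * t' i j r = t' i j r * x) ->
  forall i j r, x * tmul t t' i j r = tmul t t' i j r * x.
Proof.
move=> h h' i j r; rewrite /tmul fps_sum mulr_sumr mulr_suml; apply: eq_bigr => c _.
rewrite fpsM /mulS mulr_sumr mulr_suml; apply: eq_bigr => a _.
have e (u : 'I_n -> 'I_n -> nat -> B) (hu : forall i j r, x * u i j r = u i j r * x) b d r' :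
    x * tser u b d r' = tser u b d r' * x by case: r' => [|r'] //=; apply: commr_nat.
by rewrite mulrA e // -!mulrA e.
Qed.

Lemma sitesT_comm_elt s ks x : (forall k i j, k \in ks -> x * siteE s k i j = siteE s k i j * x) ->
  forall i j r, x * sitesT s ks i j r = sitesT s ks i j r * x.
Proof.
elim: ks => [|k ks IH] h; first by move=> i j r; rewrite mulr0 mul0r.
apply: tmul_comm_elt.
  by move=> i j r; rewrite -scalerAl -scalerAr h ?mem_head.
by apply: IH => k' i j k'ks; apply: h; rewrite inE k'ks orbT.
Qed.

Lemma OY_rel_triv : OY_rel beta (fun (_ _ : 'I_n) (_ : nat) => 0 : B).
Proof.
move=> i j k l a b X.
have X0 p q : X p q = 0.
  rewrite /X; case: p => [|p]; first by rewrite commA_tcoef0l.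
  by rewrite /commA /= mul0r mulr0 subrr.
rewrite !X0; case: a => [|a]; case: b => [|b];
  rewrite ?X0 ?scaler0 ?addr0 ?subr0 /= ?mulr0 ?mul0r ?subr0 //.
by rewrite -!natrM mulnC !subrr.
Qed.

(** Distinct sites use disjoint oscillators and hence commute. Each new site is multiplied in on the
    left, which is where [qdet_tmul] asks for the column relation. *)
Lemma sitesT_spec s ks : uniq ks ->
  OY_rel beta (sitesT s ks) /\ qdet_central psi (sitesT s ks).
Proof.
elim: ks => [_|k ks IH /= /andP [kks /IH [IH1 IH2]]].
  by split; [apply: OY_rel_triv | move=> i j r m; rewrite mul0r mulr0].
have c i j r i' j' r' : one_site s k i j r * sitesT s ks i' j' r'
    = sitesT s ks i' j' r' * one_site s k i j r.
  apply: sitesT_comm_elt => k' i2 j2 k'ks; rewrite -scalerAl -scalerAr siteE_comm0 //.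
  by apply: contraNneq kks => ->.
have gl := siteE_gl s k.
split; first by apply: OY_rel_tmul => //; apply: OY_rel_site.
apply: qdet_central_tmul => //; first by apply: qfactor_site_adj.
by apply: qdet_central_site.
Qed.

Lemma ord_siteE k i j : ord 2 (mu k i * xi k j) (fun s => siteE s k i j).
Proof. by apply: (@ord_M _ _ 1 1); [apply: ord_raise | apply: ord_lower]. Qed.

Lemma site_coef_poly a r : exists P : {poly C},
  [/\ (size P <= (4 * r).+1)%N, P`_(4 * r) = a ^+ r &
      forall s, site_coef beta (s ^+ 4 * a) r.+1 = P.[s]].
Proof.
elim/ltn_ind: r => -[|[|r]] IH.
- by exists 1; split; rewrite ?size_poly1 ?coefC // => s; rewrite hornerC.
- exists (a *: 'X^4); split.
  + by apply: leq_trans (size_scale_leq _ _) _; rewrite size_polyXn.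
  + by rewrite coefZ coefXn eqxx mulr1.
  + by move=> s; rewrite hornerZ hornerXn site_coefS /site_coef /=; ring.
have [P [hP eP vP]] := IH r.+1 (ltnSn _); have [Q [hQ _ vQ]] := IH r (leqnSn _).
have sz : (size ((a *: 'X^4) * P)%R <= (4 * r.+2).+1)%N.
  apply: leq_trans (size_polyMleq _ _) _.
  have h : (size (a *: 'X^4 : {poly C}) <= 5)%N.
    by apply: leq_trans (size_scale_leq _ _) _; rewrite size_polyXn.
  by apply: leq_trans (pred_add_le h hP) _; lia.
exists ((a *: 'X^4) * P - beta *: Q); split.
- apply: leq_trans (size_polyD _ _) _; rewrite geq_max sz size_polyN.
  by apply: leq_trans (size_scale_leq _ _) _; apply: leq_trans hQ _; lia.
- rewrite coefB !coefZ -scalerAl coefZ coefXnM [Q`_ _]nth_default; last first.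
    by apply: leq_trans hQ _; lia.
  rewrite mulr0 subr0 (_ : 4 * r.+2 - 4 = 4 * r.+1)%N; last by lia.
  by rewrite (_ : (4 * r.+2 < 4)%N = false) ?eP -?exprS //; lia.
- move=> s; rewrite site_coefS vP vQ hornerD hornerN hornerM !hornerZ hornerXn; ring.
Qed.

Lemma ord_one_site k i j r :
  ord (4 * r + 2) (al k ^+ r * (mu k i * xi k j)) (fun s => one_site s k i j r.+1).
Proof.
have [P [hP <- vP]] := site_coef_poly (al k) r.
rewrite addnC; have := ord_scale hP (ord_siteE k i j).
have -> // : (fun s => P.[s] *: siteE s k i j) = (fun s => one_site s k i j r.+1).
by apply: funext => s; rewrite /one_site /site_t vP.
Qed.

(** Leading parts add: a cross term has order (4a + 2) + (4(r - a - 1) + 2) = 4r, below 4r + 2. *)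
Lemma ord_tmul (t t' : C -> 'I_n -> 'I_n -> nat -> B) (X X' : 'I_n -> 'I_n -> nat -> C) :
  (forall i j r, ord (4 * r + 2) (X i j r) (fun s => t s i j r.+1)) ->
  (forall i j r, ord (4 * r + 2) (X' i j r) (fun s => t' s i j r.+1)) ->
  forall i j r, ord (4 * r + 2) (X i j r + X' i j r) (fun s => tmul (t s) (t' s) i j r.+1).
Proof.
move=> h h' i j r.
have -> : (fun s => tmul (t s) (t' s) i j r.+1) = (fun s => t s i j r.+1 + t' s i j r.+1
    + \sum_c \sum_(a < r) t s i c a.+1 * t' s c j (r - a)%N).
  apply: funext => s; rewrite /tmul fps_sum.
  have -> : t' s i j r.+1 = \sum_c tser (t s) i c 0%N * tser (t' s) c j r.+1.
    rewrite (bigD1 i) //= eqxx mul1r big1 ?addr0 // => c ci.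
    by rewrite eq_sym (negbTE ci) mul0r.
  have -> : t s i j r.+1 = \sum_c tser (t s) i c r.+1 * tser (t' s) c j 0%N.
    by rewrite (bigD1 j) //= eqxx mulr1 big1 ?addr0 // => c /negbTE ->; rewrite mulr0.
  rewrite -!big_split; apply: eq_bigr => c _ /=.
  rewrite fpsM /mulS big_ord_recl big_ord_recr /= /bump /= subn0 subnn.
  rewrite [RHS]addrAC [RHS]addrC; congr (_ + _); rewrite addrC; congr (_ + _).
  apply: eq_bigr => a _; rewrite /bump /= add1n subSS /tser /=.
  by case E: (r - a)%N (subn_gt0 a r) => [|k] //=; rewrite ltn_ord.
rewrite -[X i j r + _]addr0; apply: ord_D; first by apply: ord_D.
have -> : (0 : C) = \sum_(c < n) 0 by rewrite big1.
apply: ord_sum => c; have -> : (0 : C) = \sum_(a < r) 0 by rewrite big1.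
apply: ord_sum => a; have ar := ltn_ord a.
have -> : (r - a)%N = (r - a.+1).+1 by rewrite subnSK.
by apply: (ord_lt _ (ord_M (h i c a) (h' c j (r - a.+1)%N))); lia.
Qed.

Lemma ord_sitesT ks i j r :
  ord (4 * r + 2) (\sum_(k <- ks) al k ^+ r * (mu k i * xi k j))
    (fun s => sitesT s ks i j r.+1).
Proof.
elim: ks i j r => [|k ks IH] i j r; first by rewrite big_nil; apply: ord_0.
rewrite big_cons; exact: (@ord_tmul (one_site^~ k) (sitesT^~ ks)
  (fun i j r => al k ^+ r * (mu k i * xi k j))
  (fun i j r => \sum_(k <- ks) al k ^+ r * (mu k i * xi k j)) (ord_one_site k) IH i j r).
Qed.

Definition site_point : point C n :=
  fun l => \sum_(k : J) al k ^+ l.2 * (mu k l.1.1 * xi k l.1.2).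
Definition site_letter (s : C) (l : letter n) : B := sitesT s (enum J) l.1.1 l.1.2 l.2.+1.

Lemma ord_wev w : ord (2 * wt w) (wpt site_point w) (fun s => wev (site_letter s) w).
Proof.
elim: w => [|l w IH].
  have -> : (fun s => wev (site_letter s) [::]) = (fun=> 1).
    by apply: funext => s; rewrite /wev big_nil.
  by rewrite /wt /wpt !big_nil; apply: ord_1.
have -> : (fun s => wev (site_letter s) (l :: w))
    = (fun s => site_letter s l * wev (site_letter s) w).
  by apply: funext => s; rewrite /wev big_cons.
rewrite /wt /wpt !big_cons mulnDr; apply: ord_M => //.
rewrite /site_point -(big_enum _ _ predT) /=.
have -> : (2 * lwt l = 4 * l.2 + 2)%N by rewrite /lwt; lia.
exact: ord_sitesT.
Qed.

(** The top at [site_point] is the coefficient of order 2p in [s] of the evaluated sum. *)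
Lemma site_top0 p P : all (fun cw : C * seq (letter n) => wt cw.2 <= p)%N P ->
  (forall s, sev (site_letter s) P = 0) -> top p P site_point = 0.
Proof.
move=> hP h0; suff H : ord (2 * p) (top p P site_point) (fun s => sev (site_letter s) P).
  exact: ord_zero H h0.
elim: P {h0} hP => [_|cw P IH /= /andP [hcw /IH {}IH]].
  have -> : (fun s => sev (site_letter s) [::]) = (fun=> 0).
    by apply: funext => s; rewrite /sev big_nil.
  by rewrite /top big_nil; apply: ord_0.
have -> : (fun s => sev (site_letter s) (cw :: P))
    = (fun s => cw.1 *: wev (site_letter s) cw.2 + sev (site_letter s) P).
  by apply: funext => s; rewrite /sev big_cons.
have -> : top p (cw :: P) site_point
    = (if wt cw.2 == p then cw.1 * wpt site_point cw.2 else 0) + top p P site_point.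
  by rewrite /top big_cons; case: eqP; rewrite ?add0r.
apply: ord_D => //; case: eqP hcw => [<- _|/eqP ne hcw].
  by apply: ord_Z; apply: ord_wev.
apply: (ord_lt _ (ord_Z cw.1 (ord_wev cw.2))).
by rewrite ltn_pmul2l // ltn_neqAle ne.
Qed.

End MultiSite.

(** * Faithfulness and centrality *)

Lemma vandermonde_solve (F : numFieldType) (M : nat) (y : 'I_M -> F) :
  exists c : 'I_M -> F, forall r : 'I_M, \sum_(k < M) k%:R ^+ r * c k = y r.
Proof.
pose a : 'rV[F]_M := \row_k (k%:R).
have V : Vandermonde M a \in unitmx.
  rewrite unitmxE det_Vandermonde unitfE; apply/prodf_neq0 => i _; apply/prodf_neq0 => j ij.
  by rewrite !mxE subr_eq0 Num.Theory.eqr_nat neq_ltn ij orbT.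
pose c := invmx (Vandermonde M a) *m (\col_r y r).
exists (fun k => c k 0) => r.
have := congr1 (fun m : 'cV_M => m r 0) (mulKVmx V (\col_r y r)); rewrite -/c !mxE => <-.
by apply: eq_bigr => k _; rewrite !mxE.
Qed.

Section AlgHom.
Variables (R : realType) (A B : algType R[i]) (f : A -> B).
Hypothesis hf : alg_hom f.
Local Notation C := (R[i]).

Definition hom_of of alg_hom f := f.
Local Notation F := (hom_of hf).

Fact hom_of_zmod : zmod_morphism F.
Proof.
have [fD _ _ fZ] := hf => x y.
by rewrite /hom_of fD -[- y]scaleN1r fZ scaleN1r.
Qed.
Fact hom_of_monoid : monoid_morphism F.
Proof. by have [_ fM f1 _] := hf; split. Qed.
HB.instance Definition _ := GRing.isZmodMorphism.Build A B F hom_of_zmod.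
HB.instance Definition _ := GRing.isMonoidMorphism.Build A B F hom_of_monoid.

Lemma hom_ofZ c x : F (c *: x) = c *: F x.
Proof. by have [_ _ _] := hf; apply. Qed.

Variables (n : nat) (t : 'I_n -> 'I_n -> nat -> A) (t' : 'I_n -> 'I_n -> nat -> B).
Hypothesis ft : forall i j r, (0 < r)%N -> f (t i j r) = t' i j r.

Lemma hom_qdet psi m : f (qdet psi t m) = qdet psi t' m.
Proof.
have E k i j : fps_map F (qfactor psi t k i j) = qfactor psi t' k i j.
  apply: funext => q; rewrite /fps_map /qfactor /fps_subst rmorph_sum; apply: eq_bigr => r _ /=.
  rewrite hom_ofZ; congr (_ *: _); case: (val r) => [|r'] /=; first by rewrite rmorph_nat.
  exact: ft.
rewrite !qdetE -[LHS]/(fps_map F _ m); congr (_ m).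
rewrite /qminor rmorph_sum; apply: eq_bigr => s _.
rewrite rmorphM rmorph_prod rmorph_sign.
by under eq_bigr => k _ do rewrite /= E.
Qed.

Lemma hom_sev (P : wordsum C n) :
  f (sev (fun l => t l.1.1 l.1.2 l.2.+1) P) = sev (fun l => t' l.1.1 l.1.2 l.2.+1) P.
Proof.
rewrite -[LHS]/(F _) /sev rmorph_sum; apply: eq_bigr => p _.
rewrite [LHS]hom_ofZ; congr (_ *: _); rewrite /wev rmorph_prod; apply: eq_bigr => l _.
exact: ft.
Qed.

End AlgHom.

Lemma wt_letter n (w : seq (letter n)) l : l \in w -> (l.2 <= wt w)%N.
Proof.
elim: w => // a w IH; rewrite inE wt_cons => /orP [/eqP ->|/IH].
  by rewrite /lwt; lia.
by lia.
Qed.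

Lemma wpt_ext (K : comNzRingType) n (X X' : point K n) w :
  (forall l, l \in w -> X l = X' l) -> wpt X w = wpt X' w.
Proof. by move=> h; rewrite /wpt big_seq [RHS]big_seq; apply: eq_bigr => l; apply: h. Qed.

Lemma top_ext (K : comNzRingType) n p (P : wordsum K n) (X X' : point K n) :
  (forall l, (l.2 <= p)%N -> X l = X' l) -> top p P X = top p P X'.
Proof.
move=> h; apply: eq_bigr => cw /eqP wp; congr (_ * _); apply: wpt_ext => l lw.
by apply: h; rewrite -wp; apply: wt_letter.
Qed.

(** Take a site for each matrix unit E_ab and each parameter q < M, carrying a multiple of E_ab; a
    Vandermonde system fixes the multiples from the prescribed entries at levels below M. *)
Lemma site_point_surj (R : realType) n (X : point R[i] n) (M : nat) :
  exists (J : finType) (al : J -> R[i]) (mu xi : J -> 'I_n -> R[i]),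
    forall l, (l.2 < M)%N -> site_point al mu xi l = X l.
Proof.
have [c hc] : exists c : 'I_n -> 'I_n -> 'I_M -> R[i],
    forall i j (r : 'I_M), \sum_(k < M) k%:R ^+ r * c i j k = X (i, j, nat_of_ord r).
  exists (fun i j => sval (cid (vandermonde_solve (fun r : 'I_M => X (i, j, nat_of_ord r))))).
  by move=> i j r; case: (cid _).
exists ('I_n * 'I_n * 'I_M)%type, (fun k : 'I_n * 'I_n * 'I_M => (k.2 : nat)%:R),
  (fun k i => c k.1.1 k.1.2 k.2 * (i == k.1.1)%:R), (fun k j => (j == k.1.2)%:R).
move=> [[i j] r] /= rM; rewrite -(hc i j (Ordinal rM)) /site_point /=.
rewrite -(pair_bigA _ (fun (k : 'I_n * 'I_n) (q : 'I_M) => q%:R ^+ r *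
   (c k.1 k.2 q * (i == k.1)%:R * (j == k.2)%:R))) /=.
rewrite -(pair_bigA _ (fun (a b : 'I_n) => \sum_(q < M) q%:R ^+ r *
   (c a b q * (i == a)%:R * (j == b)%:R))) /=.
rewrite (bigD1 i) //= [X in _ + X]big1 ?addr0; last first.
  move=> a /negbTE ai; rewrite big1 // => b _; rewrite big1 // => q _.
  by rewrite eq_sym ai mulr0 mul0r mulr0.
rewrite (bigD1 j) //= [X in _ + X]big1 ?addr0; last first.
  move=> b /negbTE bj; rewrite big1 // => q _.
  by rewrite [j == b]eq_sym bj !mulr0.
by apply: eq_bigr => q _; rewrite !eqxx !mulr1.
Qed.

Section Generation.
Variables (R : realType) (n : nat) (beta : R[i]) (A : algType R[i])
  (t : 'I_n -> 'I_n -> nat -> A).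
Local Notation C := (R[i]).
Hypothesis At : is_OY beta t.

Definition is_gen (y : A) : Prop := exists i j r, y = t i j r.+1.

(** The generated subalgebra also carries a solution, so the universal property gives a map into it;
    followed by the inclusion, it is the identity by uniqueness. *)
Lemma OY_gen y : subalg_gen is_gen y.
Proof.
have gP i j r : (0 < r)%N -> t i j r \in subalg_pred is_gen.
  by case: r => // r _; apply/asboolP; apply: sg_in; exists i, j, r.
(* At [r = 0] the value may be the default 0; [tcoef] never reads it. *)
pose t' i j r : subalg is_gen := insubd 0 (t i j r).
have vt i j r : (0 < r)%N -> val (t' i j r) = t i j r.
  by move=> r0; rewrite val_insubd gP.
have vtc i j r : val (tcoef t' i j r) = tcoef t i j r.
  by case: r => [|r]; rewrite /tcoef ?vt // rmorph_nat.
have OYt' : OY_rel beta t'.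
  move=> i j k l a b X; apply: val_inj.
  have vB (u v : subalg is_gen) : val (u - v) = val u - val v by apply: rmorphB.
  have vD (u v : subalg is_gen) : val (u + v) = val u + val v by apply: rmorphD.
  have vM (u v : subalg is_gen) : val (u * v) = val u * val v by apply: rmorphM.
  have vZ c (u : subalg is_gen) : val (c *: u) = c *: val u by apply: linearZ.
  have v0 : val (0 : subalg is_gen) = 0 by apply: rmorph0.
  have vX p q : val (X p q) = commA (tcoef t i j p) (tcoef t k l q).
    by rewrite /X /commA vB !vM !vtc.
  rewrite !vB vD !vM !vX !vtc -(At.1 i j k l a b).
  by congr (_ + _ - _ - _); [case: (a) | case: (b)] => // q; rewrite vZ vX.
have [[f [hf ft]] _] := At.2 _ _ OYt'.
have [_ uniq] := At.2 _ _ At.1.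
have -> : y = val (f y).
  apply: (uniq id (fun z => val (f z))) => //.
    case: hf => fD fM f1 fZ; split.
    - by move=> u v; rewrite fD rmorphD.
    - by move=> u v; rewrite fM rmorphM.
    - by rewrite f1 rmorph1.
    - by move=> c u; rewrite fZ linearZ.
  by move=> i j r r0; rewrite ft // vt.
by have /asboolP := valP (f y).
Qed.

Local Notation x := (fun l : letter n => t l.1.1 l.1.2 l.2.+1).

Lemma OY_Lt y : exists p, Lt x p y.
Proof.
elim: {y}(OY_gen y) => [y [i [j [r ->]]]|c|y z _ [p hp] _ [q hq]|y z _ [p hp] _ [q hq]].
- by exists (2 * r + 2)%N; apply: Lt_t; lia.
- by exists 1%N; apply: Lt_alg.
- exists (p + q)%N; apply: Lt_D; [apply: Lt_le hp | apply: Lt_le hq]; lia.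
- by exists (p + q).-1; apply: Lt_M.
Qed.

Lemma central_gen z : (forall i j r, z * t i j r.+1 = t i j r.+1 * z) -> forall y, z * y = y * z.
Proof.
move=> hz y; elim: {y}(OY_gen y) => [y [i [j [r ->]]]|c|y y' _ hy _ hy'|y y' _ hy _ hy'].
- exact: hz.
- by rewrite -scalerAl -scalerAr mul1r mulr1.
- by rewrite mulrDr mulrDl hy hy'.
- by rewrite mulrA hy -mulrA hy' mulrA.
Qed.

Variable psi : C -> nat -> C.
Hypothesis psiP : forall c, phi_inv_spec beta c (psi c).

Lemma eval_hom (J : finType) (al : J -> C) (mu xi : J -> 'I_n -> C) s :
  exists f : A -> oper C (J * 'I_n)%type, alg_hom f /\
    forall i j r, (0 < r)%N -> f (t i j r) = sitesT beta al mu xi s (enum J) i j r.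
Proof.
have [h _] := sitesT_spec psiP al mu xi s (enum_uniq J).
by have [] := At.2 _ _ h.
Qed.

Lemma top_eq0 p P : all (fun cw : C * seq (letter n) => wt cw.2 <= p)%N P ->
  (forall (J : finType) (al : J -> C) (mu xi : J -> 'I_n -> C) s
     (f : A -> oper C (J * 'I_n)%type), alg_hom f ->
     (forall i j r, (0 < r)%N -> f (t i j r) = sitesT beta al mu xi s (enum J) i j r) ->
     f (sev x P) = 0) ->
  forall X, top p P X = 0.
Proof.
move=> hP h X; have [J [al [mu [xi hX]]]] := site_point_surj X p.+1.
rewrite -(top_ext P (X := site_point al mu xi)) => [|l lp]; last exact: hX.
apply: (site_top0 (beta := beta)) => // s; have [f [hf ft]] := eval_hom al mu xi s.
by rewrite /site_letter -(hom_sev hf ft); apply: h hf ft.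
Qed.

(** The top of an expression of [y] vanishes at every point, so [y] has lower weight than assumed;
    descend until the weight bound is 0. *)
Lemma eval_faithful y :
  (forall (J : finType) (al : J -> C) (mu xi : J -> 'I_n -> C) s
     (f : A -> oper C (J * 'I_n)%type), alg_hom f ->
     (forall i j r, (0 < r)%N -> f (t i j r) = sitesT beta al mu xi s (enum J) i j r) ->
     f y = 0) -> y = 0.
Proof.
move=> h; have [p] := OY_Lt y; elim: p => [/Lt0 //|p IH [P hP yP]].
apply: IH; apply: (Sy0_Lt At.1 (f := top p P)); first by exists P.
by apply: top_eq0 => //; rewrite -yP.
Qed.

Lemma Sy_uniq p f : Sy x p f 0 -> forall X, f X = 0.
Proof.
move=> [P [hP P0 hf]] X; rewrite hf; apply: top_eq0 => // J al mu xi s g [gD _ _ _] _.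
by rewrite -P0; have := gD 0 0; rewrite addr0 => /eqP; rewrite -{1}[g 0]addr0 (inj_eq (addrI _)) => /eqP.
Qed.

(** A commutator with a generator dies in every site representation, where the determinant commutes
    with the generators. *)
Lemma qdet_is_central m y : qdet psi t m * y = y * qdet psi t m.
Proof.
apply: central_gen => i j r; apply/eqP; rewrite -subr_eq0; apply/eqP.
apply: eval_faithful => J al mu xi s f hf ft.
have [_ h] := sitesT_spec psiP al mu xi s (enum_uniq J).
have [fD fM f1 fZ] := hf.
rewrite -[- _]scaleN1r fD fZ !fM ft // (hom_qdet hf ft) h scaleN1r subrr //.
Qed.

End Generation.

(** * The symbol of the quantum determinant *)

Section QdetSymbol.
Variables (R : realType) (n : nat) (A : algType R[i]) (t : 'I_n -> 'I_n -> nat -> A).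
Local Notation C := (R[i]).
Local Notation x := (fun l : letter n => t l.1.1 l.1.2 l.2.+1).

(* The pairs (a, y) multiply like dual numbers. *)
Definition fps_symbol (a : C) (y : nat -> point C n -> C) (f : fps A) : Prop :=
  f 0%N = a%:A /\ forall m, Sy x (2 * m).+1 (y m) (f m.+1).

(** A cross term has weight at most (2q + 1) + (2(m - q - 1) + 1) = 2m, below 2m + 1. *)
Lemma fps_symbolM a b y z f g : fps_symbol a y f -> fps_symbol b z g ->
  fps_symbol (a * b) (fun m X => a * z m X + b * y m X) (f * g).
Proof.
move=> [f0 hf] [g0 hg]; split.
  by rewrite fpsM0 f0 g0 -scalerAl mul1r scalerA.
move=> m; rewrite fpsM /mulS big_ord_recl big_ord_recr /= /bump /= subn0 add1n subnn f0 g0.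
rewrite -scalerAl mul1r -scalerAr mulr1 addrCA addrC.
apply: Sy_addLt.
  by apply: Sy_D; apply: Sy_Z.
apply: Lt_sum => q _; rewrite /bump /= add1n subSS; have qm := ltn_ord q.
have -> : (m - q = (m - q.+1).+1)%N by rewrite subnSK.
have := Lt_M (Sy_Lt (hf q)) (Sy_Lt (hg (m - q.+1)%N)).
by apply: Lt_le; lia.
Qed.

Lemma fps_symbol_prod k (a : 'I_k -> C) y (f : 'I_k -> fps A) :
  (forall q, fps_symbol (a q) (y q) (f q)) ->
  fps_symbol (\prod_q a q) (fun m X => \sum_p (\prod_(q | q != p) a q) * y p m X) (\prod_q f q).
Proof.
elim: k a y f => [|k IH] a y f h.
  rewrite !big_ord0; split; first by rewrite scale1r.
  move=> m; apply: Sy_ext (Lt_Sy (Lt_0 _ _)) => X; by rewrite big_ord0.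
rewrite !big_ord_recl; have [h0 h1] := fps_symbolM (h ord0) (IH _ _ _ (fun q => h (lift ord0 q))).
split=> // m; apply: Sy_ext (h1 m) => X; rewrite big_ord_recl addrC; congr (_ + _).
  by rewrite [in RHS]big_mkcond big_ord_recl /= mul1r.
rewrite mulr_sumr; apply: eq_bigr => p _; rewrite mulrA; congr (_ * _).
by rewrite [in RHS]big_mkcond big_ord_recl /= [in LHS]big_mkcond.
Qed.

Lemma fps_symbol_qfactor (psi : C -> nat -> C) k i j :
  (forall c, psi c 0%N = 0) -> (forall c, psi c 1%N = 1) ->
  fps_symbol (i == j)%:R (fun m X => X (i, j, m)) (qfactor psi t k i j).
Proof.
move=> p0 p1; rewrite /qfactor; set ps := psi _.
(* Since psi starts with w, its power psi^(m+1) starts with w^(m+1): t^(m+1) enters the coefficient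
   m+1 with factor 1, and the other terms have lower weight. *)
have psd m : powS ps m m = 1.
  elim: m => // m IH; rewrite -[LHS]/(mulS ps (powS ps m) m.+1) /mulS 2!big_ord_recl /=.
  rewrite {1}/ps p0 mul0r add0r {1}/ps p1 mul1r /bump /= subSS subn0 IH big1 ?addr0 // => q _.
  by rewrite powSE powS_small ?mulr0 //; [apply: p0 | rewrite /bump /=; have := ltn_ord q; lia].
split.
  by rewrite /fps_subst big_ord1 /= /oneS scale1r scaler_nat.
move=> m.
have -> : fps_subst ps (tser t i j) m.+1
    = t i j m.+1 + \sum_(r < m.+1) powS ps r m.+1 *: tcoef t i j r.
  rewrite [LHS]big_ord_recr [LHS]addrC; congr (_ + _).
  by rewrite -[LHS]/(powS ps m.+1 m.+1 *: t i j m.+1) psd scale1r.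
apply: Sy_addLt; first exact: (Sy_letter x (i, j, m)).
apply: Lt_sum => -[[|r] rm] _ /=; apply: Lt_Z.
  by rewrite -scaler_nat; apply: Lt_alg.
by apply: Lt_t; lia.
Qed.

Lemma perm_fix_but_one (s : 'S_n) p : (forall q, q != p -> s q = q) -> s = 1%g.
Proof.
move=> h; apply/permP => q; rewrite perm1; case: (eqVneq q p) => [->|/h //].
by apply/eqP; apply: contraT => sp; move/perm_inj: (h _ sp) => /eqP; rewrite (negbTE sp).
Qed.

(** A permutation other than 1 moves at least two points, so its product of dual numbers contains
    two factors with zero constant term; only [s = 1] contributes. *)
Lemma Sy_qdet (psi : C -> nat -> C) m :
  (forall c, psi c 0%N = 0) -> (forall c, psi c 1%N = 1) ->
  Sy x (2 * m).+1 (fun X => \sum_i X (i, i, m)) (qdet psi t m.+1).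
Proof.
move=> p0 p1; rewrite qdetE /qminor fps_sum.
have h (s : 'S_n) : Sy x (2 * m).+1
   (fun X => (-1) ^+ odd_perm s *
      \sum_p (\prod_(q | q != p) (s q == q)%:R) * X (s p, p, m))
   (((-1) ^+ odd_perm s * \prod_k qfactor psi t k (s k) k : fps A) m.+1).
  have [_ /(_ m) hs] := fps_symbol_prod (fun q => fps_symbol_qfactor q (s q) q p0 p1).
  case: (odd_perm s); last first.
    by rewrite expr0 mul1r; apply: Sy_ext hs => X; rewrite /= mul1r.
  have := Sy_Z (-1) hs; rewrite scaleN1r expr1 mulN1r fpsN; exact: Sy_ext.
apply: Sy_ext (Sy_sum _ h) => X.
rewrite (bigD1 (1%g : 'S_n)) //= odd_perm1 expr0 mul1r [X in _ + X]big1 ?addr0.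
  by apply: eq_bigr => p _; rewrite perm1 big1 ?mul1r // => q _; rewrite perm1 eqxx.
move=> s s1; rewrite big1 ?mulr0 // => p _.
have /existsP [q /andP [qp sq]] : [exists q, (q != p) && (s q != q)].
  apply: contraR s1 => /existsPn hn; apply/eqP; apply: (@perm_fix_but_one _ p) => q qp.
  by have := hn q; rewrite qp negbK => /eqP.
by rewrite (bigD1 q) //= (negbTE sq) !mul0r.
Qed.

End QdetSymbol.

(** * Symbols of central elements *)

Section Derivatives.
Variables (K : numFieldType) (n : nat).
Implicit Types (X Y Z : point K n) (w : seq (letter n)).

Lemma poly_deriv0_const (G : {poly K}) : G^`() = 0 -> forall a b, G.[a] = G.[b].
Proof.
move=> dG; suff -> : G = (G`_0)%:P by move=> a b; rewrite !hornerC.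
apply/polyP => -[|k]; first by rewrite coefC.
have := congr1 (fun p : {poly K} => p`_k) dG; rewrite coef_deriv coef0 coefC /= => /eqP.
by rewrite Num.Theory.mulrn_eq0 => /orP [//|/eqP].
Qed.

Definition line X Y (tau : K) : point K n := fun l => X l + tau * Y l.

Definition word_poly X Y w : {poly K} := \prod_(l <- w) ((X l)%:P + Y l *: 'X).

Lemma word_polyE X Y w tau : (word_poly X Y w).[tau] = wpt (line X Y tau) w.
Proof.
rewrite /word_poly /wpt horner_prod; apply: eq_bigr => l _.
by rewrite hornerD hornerC hornerZ hornerX mulrC.
Qed.

End Derivatives.

Section Center.
Variables (R : realType) (n : nat) (beta : R[i]) (A : algType R[i])
  (t : 'I_n -> 'I_n -> nat -> A).
Local Notation C := (R[i]).
Hypothesis At : is_OY beta t.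
Variable psi : C -> nat -> C.
Hypothesis psiP : forall c, phi_inv_spec beta c (psi c).
Variable o : 'I_n.
Local Notation x := (fun l : letter n => t l.1.1 l.1.2 l.2.+1).
Implicit Types (X Y Z : point C n) (w : seq (letter n)).

Lemma word_poly_deriv X Y w tau :
  (word_poly X Y w)^`().[tau] = dpt (line X Y tau) Y w.
Proof.
elim: w => [|l w IH]; first by rewrite /word_poly big_nil derivC horner0.
rewrite /word_poly big_cons -/(word_poly X Y w) derivM derivD derivC add0r derivZ derivX.
rewrite hornerD !hornerM IH word_polyE hornerZ hornerC mulr1 hornerD hornerC hornerZ hornerX.
by rewrite [Y l * tau]mulrC.
Qed.

Lemma dpt_ext X X' Y Y' w : (forall l, l \in w -> X l = X' l) ->
  (forall l, l \in w -> Y l = Y' l) -> dpt X Y w = dpt X' Y' w.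
Proof.
elim: w => //= l w IH hX hY; rewrite hX ?hY ?mem_head //.
rewrite (wpt_ext (X' := X')) ?IH // => l' l'w; first [apply: hX | apply: hY];
  by rewrite inE l'w orbT.
Qed.

Lemma dpt_sum I (r : seq I) X (F : I -> point C n) w :
  dpt X (fun l => \sum_(j <- r) F j l) w = \sum_(j <- r) dpt X (F j) w.
Proof.
elim: w => [|l w IH] /=; first by rewrite big1.
by rewrite IH mulr_suml mulr_sumr -big_split.
Qed.

(** The matrix commutator [Z, E_lk], at each level. *)
Definition coadj (k l : 'I_n) Z : point C n :=
  fun a => (k == a.1.2)%:R * Z (a.1.1, l, a.2) - (a.1.1 == l)%:R * Z (k, a.1.2, a.2).

(** A normal form that keeps only the traces: at each level the trace of [X] times E_oo. *)
Definition trace_point X : point C n :=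
  fun a => if (a.1.1 == o) && (a.1.2 == o) then \sum_i X (i, i, a.2) else 0.

Section OneCentral.
Variables (p : nat) (P : wordsum C n).
Hypothesis hP : all (fun cw : C * seq (letter n) => wt cw.2 <= p)%N P.
Hypothesis Pcentral : forall y, sev x P * y = y * sev x P.

(* Commuting with t^(N), N large, brings in coordinates of level at least N, on which the
   symbol does not depend: the bracket direction is therefore arbitrary. *)
Lemma top_coadj0 X Z k l :
  \sum_(cw <- P | wt cw.2 == p) cw.1 * dpt X (coadj k l Z) cw.2 = 0.
Proof.
pose N := p.+1; have := Sy_comm At.1 k l N hP.
have -> : commA (sev x P) (t k l N.+1) = 0 by rewrite /commA Pcentral subrr.
move=> H.
(* The point is [X] at levels below [N] and [Z] moved up by [N] from there on; words of weight [p]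
   read the first part and [br] reads the second. *)
have := Sy_uniq At psiP H (fun a => if (a.2 < N)%N then X a else Z (a.1, a.2 - N)%N).
move=> E; rewrite -[RHS]E; apply: eq_bigr => cw /eqP wp; congr (_ * _).
apply: dpt_ext => a /wt_letter; rewrite wp => ap; first by rewrite ltnS ap.
by rewrite /br /coadj /= !(ltnNge (_ + _)%N) leq_addl /= addnK.
Qed.

(** If Z_j has the j-th column of [X] as its column [o] and zeros elsewhere, then [Z_j, E_oj]
    restores that column in its place and subtracts X_jj at the entry (o, o). *)
Lemma trace_dir X a : X a - trace_point X a =
  \sum_j coadj j o (fun b => (b.1.2 == o)%:R * X (b.1.1, j, b.2)) a.
Proof.
case: a => [[i j] r]; rewrite /coadj /trace_point /= sumrB eqxx.
congr (_ - _).
  rewrite (bigD1 j) //= eqxx !mul1r big1 ?addr0 // => q /negbTE ->; by rewrite mul0r.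
case: eqP => _ /=; last by rewrite big1 // => q _; rewrite mul0r.
case: eqP => _; last by rewrite big1 // => q _; rewrite mul1r mul0r.
by apply: eq_bigr => q _; rewrite !mul1r.
Qed.

(** On the line through [trace_point X] and [X] the top is a polynomial in tau, whose derivative is
    a sum of terms killed by [top_coadj0]. *)
Lemma top_trace X : top p P X = top p P (trace_point X).
Proof.
pose Y : point C n := fun a => X a - trace_point X a.
pose G : {poly C} := \sum_(cw <- P | wt cw.2 == p) cw.1 *: word_poly (trace_point X) Y cw.2.
have GE tau : G.[tau] = top p P (line (trace_point X) Y tau).
  rewrite /G horner_sum; apply: eq_bigr => cw _; by rewrite hornerZ word_polyE.
have dG : G^`() = 0.
  apply: poly_eq0_fun => tau; rewrite /G linear_sum /= horner_sum.
  pose Z j : point C n := fun b => (b.1.2 == o)%:R * X (b.1.1, j, b.2).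
  transitivity (\sum_j \sum_(cw <- P | wt cw.2 == p)
      cw.1 * dpt (line (trace_point X) Y tau) (coadj j o (Z j)) cw.2).
    rewrite exchange_big; apply: eq_bigr => cw _.
    rewrite derivZ hornerZ word_poly_deriv -mulr_sumr; congr (_ * _).
    by rewrite -dpt_sum; apply: dpt_ext => // l _; apply: trace_dir.
  by rewrite big1 // => j _; apply: top_coadj0.
have := poly_deriv0_const dG 1 0; rewrite !GE => E.
rewrite (@top_ext _ _ _ _ X (line (trace_point X) Y 1)); last first.
  by move=> l _; rewrite /line /Y mul1r addrC subrK.
rewrite E; apply: top_ext => l _; by rewrite /line mul0r addr0.
Qed.

End OneCentral.

Local Notation is_coef := (fun y : A => exists m : nat, (1 <= m)%N /\ y = qdet psi t m).

Lemma subalg_gen0 (S : A -> Prop) : subalg_gen S 0.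
Proof. by rewrite -[0](scale0r 1); apply: sg_scal. Qed.

Lemma subalg_genZ (S : A -> Prop) c y : subalg_gen S y -> subalg_gen S (c *: y).
Proof. by move=> h; rewrite -mulr_algl; apply: sg_mul => //; apply: sg_scal. Qed.

Lemma qdet_subalg_central y : subalg_gen is_coef y -> forall u, y * u = u * y.
Proof.
elim=> {y} [y [m [_ ->]] u|c u|y z _ hy _ hz u|y z _ hy _ hz u].
- exact: (qdet_is_central At psiP).
- by rewrite -scalerAl -scalerAr mul1r mulr1.
- by rewrite mulrDl mulrDr hy hz.
- by rewrite -mulrA hz mulrA hy mulrA.
Qed.

(** Induction on the weight: [y], a polynomial in the coefficients of the determinant, has the same
    symbol as [z], so [z - y] is central of lower weight. *)
Lemma central_subalg p z : Lt x p z -> (forall u, z * u = u * z) -> subalg_gen is_coef z.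
Proof.
elim: p z => [|p IH] z; first by move=> /Lt0 -> _; apply: subalg_gen0.
move=> [P hP zP] hz.
have hP' : all (fun cw : C * seq (letter n) => wt cw.2 <= p)%N P by [].
have Pc u : sev x P * u = u * sev x P by rewrite -zP.
(* [D l] has the coordinate [l] of [trace_point] as its symbol: d_(m+1) has the trace at level m. *)
pose D (l : letter n) : A := if (l.1.1 == o) && (l.1.2 == o) then qdet psi t l.2.+1 else 0.
have hD l : Sy x (lwt l) (fun X => trace_point X l) (D l).
  rewrite /D /trace_point; case: ifP => _; last by apply: Lt_Sy; apply: Lt_0.
  by apply: Sy_qdet => c; case: (psiP c).
pose y : A := \sum_(cw <- P | wt cw.2 == p) cw.1 *: \prod_(l <- cw.2) D l.
have hy : Sy x p (fun X => top p P (trace_point X)) y by apply: (Sy_subst p P hD).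
have ygen : subalg_gen is_coef y.
  rewrite /y; elim/big_ind: _ => [|u v hu hv|cw _]; first exact: subalg_gen0.
    exact: sg_add.
  apply: subalg_genZ; elim/big_ind: _ => [|u v hu hv|l _].
  - by rewrite -[1]scale1r; apply: sg_scal.
  - exact: sg_mul.
  - rewrite /D; case: ifP => _; last exact: subalg_gen0.
    by apply: sg_in; exists l.2.+1.
rewrite -[z](subrK y); apply: sg_add => //; apply: IH; last first.
  by move=> u; rewrite mulrBl mulrBr hz (qdet_subalg_central ygen).
have hzS : Sy x p (top p P) z by exists P.
apply: (Sy0_Lt At.1 (f := fun X => top p P X + -1 * top p P (trace_point X))).
  by have := Sy_D hzS (Sy_Z (-1) hy); rewrite scaleN1r.
by move=> X; rewrite -(top_trace hP' Pc X) mulN1r subrr.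
Qed.

End Center.

Theorem mainTheorem8 (R : realType) (n : nat) (beta : R[i]) (A : algType R[i])
    (t : 'I_n -> 'I_n -> nat -> A) (psi : R[i] -> nat -> R[i]) :
  (1 <= n)%N -> beta != 0 ->
  is_OY beta t ->
  (forall c : R[i], phi_inv_spec beta c (psi c)) ->
  forall z : A,
    (forall x : A, z * x = x * z) <->
    subalg_gen (fun y : A => exists m : nat, (1 <= m)%N /\ y = qdet psi t m) z.
Proof.
move=> n_gt0 _ At psiP z; split; last exact: (qdet_subalg_central At psiP).
move=> hz; have [p hp] := OY_Lt At z.
exact: (central_subalg At psiP (Ordinal n_gt0) hp hz).
Qed.
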